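(* Let $G$ be a locally compact group, and let $\mathbb{S}_2$ be the unit sphere of $L_2(G)$, with the uniformity of the norm distance, on which $G$ acts by the left regular representation. The following are equivalent: (1) $G$ is amenable; (2) there exists a left $G$-invariant mean on the space $C^b_u(\mathbb{S}_2)$; (3) the pair $(\mathbb{S}_2,G)$ has the concentration property.
   Context: $L_2(G)$ is the complex Hilbert space formed with respect to left Haar measure. For a uniform space $X$, $C^b_u(X)$ is the commutative $C^*$-algebra of bounded uniformly continuous complex-valued functions on $X$ with the supremum norm. If a group $G$ acts on $X$ by uniform isomorphisms, a left $G$-invariant mean on $C^b_u(X)$ is a positive linear functional $\phi$ of norm $1$ with $\phi(1)=1$ such that $\phi(gf)=\phi(f)$ for all $f\in C^b_u(X)$ and $g\in G$, where $(gf)(x)=f(gx)$. For $A\subseteq X$ and an entourage $V\in\mathcal{U}_X$, $V[A]$ denotes the $V$-neighbourhood of $A$. The pair $(X,G)$ has the concentration property if every finite cover $\gamma$ of $X$ (by arbitrary subsets) contains an element $A\in\gamma$ such that for every $V\in\mathcal{U}_X$ and every finite collection $g_1,\dots,g_n\in G$, $n\geq 1$, one has $\bigcap_{i=1}^n g_i(V[A])\neq\emptyset$. *)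

(* Defs.v *)
From HB Require Import structures.
From mathcomp Require Import all_boot all_order all_algebra.
From mathcomp Require Import generic_quotient ring_quotient complex.
From mathcomp Require Import all_classical all_reals all_analysis.
From mathcomp Require Import measurable_realfun.

Set Implicit Arguments.
Unset Strict Implicit.
Unset Printing Implicit Defensive.

Import Order.TTheory GRing.Theory Num.Theory.
Import numFieldNormedType.Exports.

Local Open Scope classical_set_scope.
Local Open Scope ring_scope.
Local Open Scope complex_scope.

HB.mixin Record isTopologicalGroup G & Group G & Topological G := {
  mulg_continuous : continuous (fun x : G * G => (x.1 * x.2)%g) ;
  invg_continuous : continuous (fun x : G => x^-1%g)
}.

#[short(type="topologicalGroupType")]
HB.structure Definition TopologicalGroup :=
  {G of Group G & Topological G & isTopologicalGroup G}.

(* G with its Borel sigma-algebra; measurable types are pointed, here by 1. *)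
Definition borel (G : topologicalGroupType) : Type := G.

Section borel_instances.
Variable G : topologicalGroupType.

HB.instance Definition _ := TopologicalGroup.on (borel G).
HB.instance Definition _ := isPointed.Build (borel G) (1%g : G).

Let borel_setC (A : set (borel G)) :
  <<s @open G >> A -> <<s @open G >> (~` A).
Proof. by move=> sA; rewrite -setTD; exact: sigma_algebraCD. Qed.

HB.instance Definition _ := @isMeasurable.Build (sigma_display (@open G))
  (borel G) <<s @open G >> (@sigma_algebra0 _ setT (@open G)) borel_setC
  (@sigma_algebra_bigcup _ setT (@open G)).

End borel_instances.


Record is_left_haar (R : realType) (G : topologicalGroupType)
    (mu : set (borel G) -> \bar R) : Prop := IsLeftHaar {
  haar_neq0 : mu [set: borel G] != 0%E ;
  haar_invariant : forall (g : G) (A : set (borel G)), measurable A ->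
    mu [set (g * x)%g | x in A] = mu A ;
  haar_compact : forall K : set G, compact K -> (mu K < +oo)%E ;
  haar_outer : forall A : set (borel G), measurable A ->
    mu A = ereal_inf [set mu U | U in [set U : set G | open U /\ A `<=` U]] ;
  haar_inner : forall U : set G, open U ->
    mu U = ereal_sup [set mu K | K in [set K : set G | compact K /\ K `<=` U]]
}.

Record left_haar (R : realType) (G : topologicalGroupType) := LeftHaar {
  haar_measure :> {measure set (borel G) -> \bar R} ;
  haarP : is_left_haar haar_measure
}.

Section L2.
Context d (T : measurableType d) (R : realType).
Variable mu : {measure set T -> \bar R}.

Local Notation C := (R[i]^o).
Local Notation normc := (@Normc.normc R).

Definition cmeasurable (f : T -> C) :=
  measurable_fun [set: T] (fun x => complex.Re (f x)) /\
  measurable_fun [set: T] (fun x => complex.Im (f x)).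

Definition cabs (f : T -> C) : T -> R := fun x => normc (f x).

Definition L2pred : {pred T -> C} := fun f =>
  `[< cmeasurable f /\ finite_norm mu 2%:E (cabs f) >].

Definition L2seminorm (f : T -> C) : R :=
  fine ('N[mu]_2%:E [EFin \o cabs f])%E.

Lemma measurable_normc f : cmeasurable f ->
  measurable_fun [set: T] (cabs f).
Proof.
move=> [mre mim].
rewrite (_ : cabs f = (fun r : R => Num.sqrt r) \o
  (fun x => complex.Re (f x) ^+ 2 + complex.Im (f x) ^+ 2)); last first.
  by apply/funext => x; rewrite /cabs /=; case: (f x).
apply: measurableT_comp.
  apply: continuous_measurable_fun; exact: sqrt_continuous.
by apply: measurable_funD; apply: measurable_funX.
Qed.

Lemma cmeasurableD f g : cmeasurable f -> cmeasurable g -> cmeasurable (f + g).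
Proof.
move=> [rf imf] [rg img]; split.
  rewrite (_ : (fun _ => _) =
    (fun x => complex.Re (f x)) \+ (fun x => complex.Re (g x))).
    exact: measurable_funD.
  by apply/funext => x /=; rewrite [(f + g) x]/(f x + g x) raddfD.
rewrite (_ : (fun _ => _) =
  (fun x => complex.Im (f x)) \+ (fun x => complex.Im (g x))).
  exact: measurable_funD.
by apply/funext => x /=; rewrite [(f + g) x]/(f x + g x) raddfD.
Qed.

Lemma cmeasurableZ (a : R[i]) f : cmeasurable f -> cmeasurable (a *: f).
Proof.
move=> [rf imf]; case: a => a b; split.
  rewrite (_ : (fun _ => _) =
    (fun x => a * complex.Re (f x)) \- (fun x => b * complex.Im (f x))).
    by apply: measurable_funB; apply: measurable_funM.
  by apply/funext => x /=; rewrite [(_ *: f) x]/(_ * f x); case: (f x).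
rewrite (_ : (fun _ => _) =
  (fun x => a * complex.Im (f x)) \+ (fun x => b * complex.Re (f x))).
  by apply: measurable_funD; apply: measurable_funM.
by apply/funext => x /=; rewrite [(_ *: f) x]/(_ * f x); case: (f x).
Qed.

Lemma L2pred_LfunP f : f \in L2pred ->
  cmeasurable f /\ cabs f \in Lfun mu 2%:E.
Proof.
move=> /asboolP[mf nf]; split => //.
by apply/andP; split; rewrite inE//=; exact: measurable_normc.
Qed.

Lemma Lnorm2E (h : T -> R) : ('N[mu]_2%:E [EFin \o h] =
  (\int[mu]_x (`|(EFin \o h) x| `^ 2)) `^ 2^-1)%E.
Proof. by rewrite unlock. Qed.

Lemma le_Lnorm2 (f g : T -> R) :
  measurable_fun [set: T] f -> measurable_fun [set: T] g ->
  (forall x, 0 <= f x) -> (forall x, f x <= g x) ->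
  ('N[mu]_2%:E [EFin \o f] <= 'N[mu]_2%:E [EFin \o g])%E.
Proof.
move=> mf mg f0 fg; have g0 x : 0 <= g x by exact: le_trans (fg x).
have int0 (h : T -> R) : (\int[mu]_x (`|(EFin \o h) x| `^ 2))%E \in `[0%E, +oo%E].
  by rewrite in_itv/= leey andbT; apply: integral_ge0 => x _; rewrite lee_fin powR_ge0.
rewrite !Lnorm2E; apply: gt0_ler_poweR; [by rewrite invr_ge0|exact: int0|exact: int0|].
have mp (h : T -> R) : measurable_fun [set: T] h ->
    measurable_fun [set: T] (fun x => (`|(EFin \o h) x| `^ 2)%E).
  move=> mh; apply: (measurableT_comp (measurable_poweR _)).
  by apply: measurableT_comp => //; exact/measurable_EFinP.
apply: ge0_le_integral => //.
- by move=> x _; exact: poweR_ge0.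
- exact: mp.
- exact: mp.
move=> x _; apply: gt0_ler_poweR => //; rewrite ?in_itv/= ?leey ?lee_fin ?normr_ge0//.
by rewrite !ger0_norm.
Qed.

Lemma Lnorm2D f g : cmeasurable f -> cmeasurable g ->
  ('N[mu]_2%:E [EFin \o cabs (f + g)%R] <=
   'N[mu]_2%:E [EFin \o cabs f] +
   'N[mu]_2%:E [EFin \o cabs g])%E.
Proof.
move=> mf mg; apply: le_trans; last first.
  by apply: eminkowski; [exact: measurable_normc..|rewrite lee_fin ler1n].
apply: le_Lnorm2.
- exact/measurable_normc/cmeasurableD.
- by apply: measurable_funD; exact: measurable_normc.
- by move=> x; rewrite /cabs; case: ((f + g) x) => a b; exact: sqrtr_ge0.
- by move=> x; exact: le_normcD.
Qed.

Lemma Lnorm2Z (a : R[i]) f : f \in L2pred ->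
  ('N[mu]_2%:E [EFin \o cabs (a *: f)%R] =
   (normc a)%:E * 'N[mu]_2%:E [EFin \o cabs f])%E.
Proof.
move=> /L2pred_LfunP[mf Lf].
have := LnormZ (Lfun_Sub (lee1n 2) Lf) (normc a).
rewrite ger0_norm; last by case: (a) => ? ?; exact: sqrtr_ge0.
move=> /= <-; congr ('N[mu]__[_])%E; apply/funext => x /=.
by rewrite /cabs [(a *: f) x]/(a * f x) Normc.normcM.
Qed.

Lemma L2pred_submod_closed : submod_closed L2pred.
Proof.
split.
  apply/asboolP; split.
    by split; exact: measurable_cst.
  rewrite /finite_norm (_ : EFin \o _ = cst 0%E) ?Lnorm0//.
  by apply/funext => x /=; rewrite /cabs Normc.normc0.
move=> a f g Lf Lg; apply/asboolP.
have [mf _] := L2pred_LfunP Lf; have [mg _] := L2pred_LfunP Lg.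
split; first by apply: cmeasurableD => //; exact: cmeasurableZ.
rewrite /finite_norm; apply: le_lt_trans.
  by apply: Lnorm2D => //; exact: cmeasurableZ.
apply: lte_add_pinfty; last by case/asboolP: Lg.
rewrite Lnorm2Z//; apply: lte_mul_pinfty => //.
  by rewrite lee_fin; case: (a) => ? ?; exact: sqrtr_ge0.
by case/asboolP: Lf.
Qed.

HB.instance Definition _ :=
  GRing.isSubmodClosed.Build R[i] (T -> C) L2pred L2pred_submod_closed.

Record L2fun := L2Fun { L2val :> T -> C ; L2valP : L2val \in L2pred }.

HB.instance Definition _ := [isSub for L2val].
HB.instance Definition _ := [Choice of L2fun by <:].
HB.instance Definition _ := [SubChoice_isSubLmodule of L2fun by <:].


Definition L2null : {pred L2fun} := fun f =>
  `[< {ae mu, forall x, (f : T -> C) x = 0} >].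

Lemma L2null_zmod_closed : zmod_closed L2null.
Proof.
split; first by apply/asboolP/aeW.
move=> f g /asboolP f0 /asboolP g0; apply/asboolP.
apply: filterS2 f0 g0 => x fx0 gx0.
have sub0 (a b : R[i]) : a = 0 -> b = 0 -> a - b = 0 by move=> -> ->; rewrite subr0.
exact: (sub0 _ _ fx0 gx0).
Qed.

HB.instance Definition _ :=
  GRing.isZmodClosed.Build L2fun L2null L2null_zmod_closed.

Lemma L2nullZ (a : R[i]) f : f \in L2null -> a *: f \in L2null.
Proof.
move=> /asboolP f0; apply/asboolP; apply: filterS f0 => x fx0.
have mul0 (b : R[i]) : b = 0 -> a * b = 0 by move=> ->; rewrite mulr0.
exact: (mul0 _ fx0).
Qed.

Lemma L2seminormE (f : L2fun) :
  (L2seminorm f)%:E = 'N[mu]_2%:E [EFin \o cabs f]%E.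
Proof.
rewrite /L2seminorm fineK// ge0_fin_numE ?Lnorm_ge0//.
by case: f => f /= /asboolP[].
Qed.

Lemma L2seminormD (f g : L2fun) :
  L2seminorm (f + g : L2fun) <= L2seminorm f + L2seminorm g.
Proof.
rewrite -lee_fin EFinD !L2seminormE; apply: Lnorm2D.
  by case: f => f /= /asboolP[].
by case: g => g /= /asboolP[].
Qed.

Lemma L2seminormZ (a : R[i]) (f : L2fun) :
  L2seminorm (a *: f : L2fun) = normc a * L2seminorm f.
Proof.
by apply: EFin_inj; rewrite EFinM !L2seminormE -Lnorm2Z//; exact: L2valP.
Qed.

Lemma L2seminorm_eq0 (f : L2fun) : L2seminorm f = 0 <-> f \in L2null.
Proof.
have mf : measurable_fun [set: T] (EFin \o cabs f).
  by apply/measurable_EFinP/measurable_normc; case: f => f /= /asboolP[].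
split=> [f0|/asboolP f0].
  have : 'N[mu]_2%:E [EFin \o cabs f]%E = 0%E by rewrite -L2seminormE f0.
  move=> /(Lnorm_eq0_eq0 mf) => /(_ (ltac:(by rewrite lte_fin ltr0n))) ae0; apply/asboolP.
  by apply: filterS ae0 => x /(_ I) [/Normc.eq0_normc].
rewrite /L2seminorm Lnorm2E (_ : (\int[mu]_x _)%E = 0%E) ?poweR0r//.
rewrite (ae_eq_integral (cst 0%E)) ?integral0//.
  apply: (measurableT_comp (measurable_poweR _)).
  exact: measurableT_comp.
apply: filterS f0 => x fx0 _ /=.
by rewrite /cabs fx0 Normc.normc0 normr0 powR0.
Qed.

Definition L2 : Type := Quotient.quot L2null.

HB.instance Definition _ := EqQuotient.on L2.
HB.instance Definition _ := GRing.Zmodule.on L2.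

Local Open Scope quotient_scope.

Let L2reprK (u : L2) : \pi_L2 (repr u : L2fun) = u.
Proof. exact: reprK. Qed.

Lemma L2seminorm_pi (f : L2fun) :
  L2seminorm (repr (\pi_L2 f) : L2fun) = L2seminorm f.
Proof.
have nn (g h : L2fun) : g - h \in L2null -> L2seminorm g <= L2seminorm h.
  move=> /L2seminorm_eq0 gh0; rewrite -[g](subrK h).
  by rewrite (le_trans (L2seminormD _ _))// gh0 add0r.
have e : repr (\pi_L2 f) - f \in L2null.
  by rewrite Quotient.idealrBE reprK.
by apply/eqP; rewrite eq_le !nn// -opprB rpredN.
Qed.

Definition L2scale (a : R[i]) (u : L2) : L2 := \pi_L2 (a *: repr u : L2fun).

Definition L2norm (u : L2) : R[i] := (L2seminorm (repr u : L2fun))%:C.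

Lemma pi_L2scale (a : R[i]) (f : L2fun) : L2scale a (\pi_L2 f) = \pi_L2 (a *: f).
Proof.
apply/eqP; rewrite -Quotient.idealrBE -scalerBr; apply: L2nullZ.
by rewrite Quotient.idealrBE reprK.
Qed.

Lemma pi_L2D (f g : L2fun) : \pi_L2 f + \pi_L2 g = \pi_L2 (f + g).
Proof. by rewrite [RHS]Quotient.pi_add. Qed.

Let L2scaleA a b u : L2scale a (L2scale b u) = L2scale (a * b) u.
Proof. by rewrite -[u]L2reprK !pi_L2scale scalerA. Qed.

Let L2scale1 : left_id 1 L2scale.
Proof. by move=> u; rewrite -[u]L2reprK pi_L2scale scale1r. Qed.

Let L2scaleDr : right_distributive L2scale +%R.
Proof.
move=> a u v; rewrite -[u]L2reprK -[v]L2reprK.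
by rewrite !(pi_L2scale, pi_L2D) scalerDr.
Qed.

Let L2scaleDl u : {morph L2scale^~ u : a b / a + b}.
Proof. by move=> a b; rewrite -[u]L2reprK !(pi_L2scale, pi_L2D) scalerDl. Qed.

HB.instance Definition _ := GRing.Zmodule_isLmodule.Build R[i] L2
  L2scaleA L2scale1 L2scaleDr L2scaleDl.

Let L2normD u v : L2norm (u + v) <= L2norm u + L2norm v.
Proof.
rewrite -[u]L2reprK -[v]L2reprK pi_L2D /L2norm !L2seminorm_pi.
by rewrite -rmorphD/= lecR L2seminormD.
Qed.

Let L2normZ (a : R[i]) u : L2norm (a *: u) = `|a| * L2norm u.
Proof.
rewrite -[u]L2reprK [_ *: _]pi_L2scale /L2norm !L2seminorm_pi L2seminormZ.
by rewrite rmorphM/=; case: a.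
Qed.

Let L2norm0_eq0 u : L2norm u = 0 -> u = 0.
Proof.
rewrite -[u]L2reprK /L2norm L2seminorm_pi => -[/L2seminorm_eq0 u0].
apply/eqP; rewrite -[0](_ : \pi_L2 0 = _) -?Quotient.idealrBE ?subr0//.
by rewrite piE.
Qed.

HB.instance Definition _ := Lmodule_isNormed.Build R[i] L2
  L2normD L2normZ L2norm0_eq0.

End L2.

Section left_regular.
Variables (R : realType) (G : topologicalGroupType) (mu : left_haar R G).

Local Notation C := (R[i]^o).

Lemma measurable_mulg (g : G) :
  measurable_fun [set: borel G] (fun x : borel G => (g * x)%g : borel G).
Proof.
have ct : continuous (fun x : G => (g * x)%g).
  move=> x; apply: (@continuous_comp _ _ _ (fun y : G => (g, y))
    (fun y : G * G => (y.1 * y.2)%g)); last exact: mulg_continuous.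
  by apply: cvg_pair; [exact: cvg_cst|exact: cvg_id].
apply: (@measurability _ _ (borel G) (borel G) setT _ (@open G)) => // _ [B oB <-]; rewrite setTI.
by apply: sub_sigma_algebra; exact: open_comp.
Qed.

Definition left_translate (g : G) (f : borel G -> C) : borel G -> C :=
  fun x => f (g^-1 * x)%g.

Lemma cmeasurable_left_translate g f :
  cmeasurable f -> cmeasurable (left_translate g f).
Proof.
move=> [rf imf]; split.
  exact: (measurableT_comp rf (measurable_mulg _)).
exact: (measurableT_comp imf (measurable_mulg _)).
Qed.

Lemma haar_preimage (g : G) (A : set (borel G)) : measurable A ->
  mu ((fun x : borel G => (g^-1 * x)%g : borel G) @^-1` A) = mu A.
Proof.
move=> mA; rewrite -(haar_invariant (haarP mu) g mA); congr (mu _).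
apply/seteqP; split => [x /= Ax|_ /= [x Ax <-]]; last by rewrite mulKg.
by exists (g^-1 * x)%g => //; rewrite mulVKg.
Qed.

Lemma Lnorm_left_translate g f : cmeasurable f ->
  ('N[mu]_2%:E [EFin \o cabs (left_translate g f)] =
   'N[mu]_2%:E [EFin \o cabs f])%E.
Proof.
move=> mf; rewrite 2!Lnorm2E.
pose h := fun x : borel G => (g^-1 * x)%g : borel G.
have mh : measurable_fun [set: borel G] h := measurable_mulg _.
pose hm := isMeasurableFun.Build _ _ _ _ _ mh.
pose hp : {mfun borel G >-> borel G} := HB.pack h hm.
rewrite -[X in (X `^ _)%E = _](@ge0_integral_pushforward _ _ _ _ _ hp _ mu setT
  (fun x => (`|(EFin \o cabs f) x| `^ 2)%E)) //.
- rewrite [X in (X `^ _)%E = _](eq_measure_integral mu)// => A mA _.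
  exact: haar_preimage.
- apply: (measurableT_comp (measurable_poweR _)).
  by apply: measurableT_comp => //; exact/measurable_EFinP/measurable_normc.
- by move=> y _; exact: poweR_ge0.
Qed.

Lemma L2pred_left_translate g f :
  f \in L2pred mu -> left_translate g f \in L2pred mu.
Proof.
move=> /asboolP[mf nf]; apply/asboolP; split.
  exact: cmeasurable_left_translate.
by rewrite /finite_norm Lnorm_left_translate.
Qed.

Definition L2translate (g : G) (f : L2fun mu) : L2fun mu :=
  L2Fun (L2pred_left_translate g (L2valP f)).

Local Open Scope quotient_scope.

Definition left_regular (g : G) (u : L2 mu) : L2 mu :=
  \pi_(L2 mu) (L2translate g (repr u)).

Lemma left_regular_pi (g : G) (f : L2fun mu) :
  left_regular g (\pi_(L2 mu) f) = \pi_(L2 mu) (L2translate g f).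
Proof.
apply/eqP; rewrite -Quotient.idealrBE; apply/L2seminorm_eq0.
set r := repr _.
have -> : L2translate g r - L2translate g f = L2translate g (r - f).
  exact/val_inj.
have rf0 : L2seminorm mu (r - f : L2fun mu) = 0.
  by apply/L2seminorm_eq0; rewrite Quotient.idealrBE reprK.
rewrite -rf0 /L2seminorm Lnorm_left_translate//.
by case: (r - f) => k /= /asboolP[].
Qed.

Lemma norm_left_regular (g : G) (u : L2 mu) : `|left_regular g u| = `|u|.
Proof.
rewrite [LHS]/(L2norm _) [RHS]/(L2norm _) /L2norm L2seminorm_pi.
rewrite /L2seminorm Lnorm_left_translate//.
by case: (repr u) => k /= /asboolP[].
Qed.

Definition L2sphere : set (L2 mu) := [set u | `|u| = 1].

Lemma left_regular_sphere (g : G) (u : L2sphere) :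
  left_regular g (val u) \in L2sphere.
Proof.
case: u => u /= us; apply/mem_set.
by rewrite /L2sphere/= norm_left_regular; exact: set_mem us.
Qed.

(* The coercion of a set to a type carries the uniformity induced by the
   ambient space, here that of the norm of L2 mu. *)
Definition sphere_action (g : G) (u : L2sphere) : L2sphere :=
  SigSub (left_regular_sphere g u).

End left_regular.

Arguments L2sphere {R G} mu.
Arguments sphere_action {R G} mu g u.

Section means.
Variable R : realType.
Local Notation C := (R[i]^o).
Local Notation normc := (@Normc.normc R).

(* m is a mean on the function space E, where equality, positivity and the
   norm are understood up to the filter F: F is {X} for a space of genuine
   functions such as C^b_u, and locally_ae for L^oo. The values of m outside E
   are irrelevant. *)
Record is_mean (X : Type) (E : set (X -> C)) (F : set_system X)
    (m : (X -> C) -> C) : Prop := IsMean {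
  mean_linear : forall (a : R[i]) (f g : X -> C), E f -> E g ->
    m (a *: f + g) = a * m f + m g ;
  mean_eq : forall f g : X -> C, E f -> E g -> F [set x | f x = g x] ->
    m f = m g ;
  mean_positive : forall f : X -> C, E f -> F [set x | 0 <= f x] -> 0 <= m f ;
  mean_norm1 : ereal_sup [set (normc (m f))%:E |
    f in [set f | E f /\ F [set x | normc (f x) <= 1]]] = 1%E ;
  mean_unit : m (fun=> 1) = 1
}.

Definition Cbu (X : uniformType) : set (X -> C) :=
  [set f : X -> C | (exists M : R, forall x, normc (f x) <= M) /\
     unif_continuous f].

Definition has_invariant_mean (X : uniformType) (G : Type)
    (act : G -> X -> X) : Prop :=
  exists phi : (X -> C) -> C, is_mean (@Cbu X) (globally [set: X]) phi /\
    forall (g : G) (f : X -> C), Cbu f -> phi (fun x => f (act g x)) = phi f.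

Section amenable.
Variables (G : topologicalGroupType) (mu : left_haar R G).

(* L^oo(G) is taken modulo locally null sets, since mu need not be
   sigma-finite. *)
Definition locally_ae : set_system (borel G) :=
  [set P | forall K : set G, compact K -> mu.-negligible (K `\` P)].

(* Borel representatives; modulo equality locally almost everywhere they give
   all of L^oo(G). *)
Definition Linfty : set (borel G -> C) :=
  [set f | cmeasurable f /\
    exists M : R, locally_ae [set x | normc (f x) <= M]].

Definition amenable : Prop :=
  exists m : (borel G -> C) -> C, is_mean Linfty locally_ae m /\
    forall (g : G) (f : borel G -> C), Linfty f ->
      m (fun x => f (g * x)%g) = m f.

End amenable.
End means.

Definition ent_neighbourhood (X : uniformType) (V : set (X * X)) (A : set X) :
  set X := [set y | exists2 x, A x & V (x, y)].

Definition concentration_property (X : uniformType) (G : Type)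
    (act : G -> X -> X) : Prop :=
  forall gamma : set (set X), finite_set gamma ->
    \bigcup_(A in gamma) A = [set: X] ->
  exists2 A, gamma A & forall V : set (X * X), entourage V ->
    forall (n : nat) (g : 'I_n -> G), (0 < n)%N ->
      \bigcap_(i in [set: 'I_n]) (act (g i) @` ent_neighbourhood V A) !=set0.

(* Main.v *)
(* If m is an invariant mean on L^oo(G), then L_2(G) has almost invariant unit
   vectors. Otherwise, for some finite family g_1, ..., g_k, the operator
   S = sum_i (g_i + g_i^-1) has norm La < N := 2k, so that for tau in
   ]1/N, 1/La[ the series eta = sum_n tau^n S^n D converges, where D is a
   positive matrix coefficient of the regular representation, made positive on
   the whole of G by means of an open sigma-compact subgroup. Since
   tau S eta <= eta, the functions x |-> ln (eta (g_i x) / eta x) are bounded;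
   by concavity of ln the sum of these logarithms over all g_i and g_i^-1 is at
   most - N ln (N tau) < 0. But u |-> m(g u - u) takes opposite values at g and
   g^-1, so that this sum has mean 0: a contradiction. This replaces the duality
   between L^1 and L^oo in the usual proof.
     An almost invariant vector belongs to some member of any finite cover, which
   gives the concentration property. Conversely, under the concentration property
   the limit along an ultrafilter all of whose members are concentrated is an
   invariant mean on C^b_u. Finally, an invariant mean phi on C^b_u of the sphere
   is transported to L^oo(G) by f |-> phi (u |-> integral of f |u|^2). *)
Require Import Defs.
From mathcomp Require Import all_boot all_order all_algebra.
From mathcomp Require Import generic_quotient ring_quotient complex.
From mathcomp Require Import all_classical all_reals all_analysis.
From mathcomp Require Import measurable_realfun ring lra.

Set Implicit Arguments.
Unset Strict Implicit.
Unset Printing Implicit Defensive.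

Import Order.TTheory GRing.Theory Num.Theory.
Import numFieldNormedType.Exports.

Local Open Scope classical_set_scope.
Local Open Scope ring_scope.

(** * Real and imaginary parts against the modulus *)

Section complex_numbers.
Variable R : realType.
Implicit Type z : R[i].

Lemma Re_le_normc z : `|complex.Re z| <= Normc.normc z.
Proof.
case: z => a b /=; rewrite -sqrtr_sqr ler_sqrt ?lerDl ?sqr_ge0//.
by rewrite addr_ge0 ?sqr_ge0.
Qed.

Lemma Im_le_normc z : `|complex.Im z| <= Normc.normc z.
Proof.
case: z => a b /=; rewrite -sqrtr_sqr ler_sqrt ?lerDr ?sqr_ge0//.
by rewrite addr_ge0 ?sqr_ge0.
Qed.

Lemma gt0_ReE z : 0 < z -> z = (complex.Re z)%:C%C.
Proof. by case: z => a b; rewrite ltcE /= => /andP[/eqP -> _]. Qed.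

End complex_numbers.

(** * Complex means built from positive real functionals *)

Section mean_of_real.
Variables (R : realType) (X : Type).
Local Notation C := (R[i]^o).
Local Notation normc := (@Normc.normc R).
Variables (E : set (X -> C)) (F : set_system X) (FF : Filter F).
Variables (ER : set (X -> R)) (L : (X -> R) -> R).
Hypothesis ERe : forall f, E f ->
  ER (fun x => complex.Re (f x)) /\ ER (fun x => complex.Im (f x)).
Hypothesis E1 : E (fun=> 1).
Hypothesis ERlin : forall (a : R) f g, ER f -> ER g -> ER (fun x => a * f x + g x).
Hypothesis Llin : forall (a : R) f g, ER f -> ER g ->
  L (fun x => a * f x + g x) = a * L f + L g.
Hypothesis Lpos : forall f, ER f -> F [set x | 0 <= f x] -> 0 <= L f.
Hypothesis L1 : L (fun=> 1) = 1.

Let ER1 : ER (fun=> 1). Proof. by have [] := ERe E1. Qed.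
Let ER0 : ER (fun=> 0). Proof. by have [] := ERe E1. Qed.

Let Lle f g : ER f -> ER g -> F [set x | f x <= g x] -> L f <= L g.
Proof.
move=> Ef Eg fg; rewrite -subr_ge0 addrC -mulN1r -Llin//; apply: Lpos; first exact: ERlin.
by apply: filterS fg => x /= fg; rewrite mulN1r addrC subr_ge0.
Qed.

Let Leq f g : ER f -> ER g -> F [set x | f x = g x] -> L f = L g.
Proof.
move=> Ef Eg fg; apply/eqP; rewrite eq_le !Lle//; apply: filterS fg => x /= -> //.
Qed.

Let L0 : L (fun=> 0) = 0.
Proof.
by have := Llin (-1) ER1 ER1; rewrite L1 mulN1r addNr.
Qed.

Let Lscale a f : ER f -> L (fun x => a * f x) = a * L f.
Proof.
move=> Ef; have := Llin a Ef ER0; rewrite L0 addr0 => <-; congr L.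
by apply/funext => x; rewrite addr0.
Qed.

Let ERscale a f : ER f -> ER (fun x => a * f x).
Proof.
move=> Ef; have := ERlin a Ef ER0; congr ER.
by apply/funext => x; rewrite addr0.
Qed.

Definition complex_mean (f : X -> C) : C :=
  (L (fun x => complex.Re (f x)) +i* L (fun x => complex.Im (f x)))%C.

Let norm_le1 f : E f -> F [set x | normc (f x) <= 1] -> normc (complex_mean f) <= 1.
Proof.
move=> Ef f1; have [Er Ei] := ERe Ef.
pose p := L (fun x => complex.Re (f x)); pose q := L (fun x => complex.Im (f x)).
(* For [z = p + i q] the value of the mean at [f], the real part of [conj z * f] is
   [p Re f + q Im f]. Its image under [L] is [|z| ^ 2], while Cauchy-Schwarz bounds it pointwise by
   [|z|] where [|f| <= 1]. Hence [|z| ^ 2 <= |z|]. *)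
have pq : p ^+ 2 + q ^+ 2 <= Num.sqrt (p ^+ 2 + q ^+ 2).
  have ERs := ERscale q Ei.
  have e1 : p ^+ 2 + q ^+ 2 =
      L (fun x => p * complex.Re (f x) + q * complex.Im (f x)).
    by rewrite Llin// Lscale.
  have e2 : Num.sqrt (p ^+ 2 + q ^+ 2) = L (fun x => Num.sqrt (p ^+ 2 + q ^+ 2) * 1).
    by rewrite Lscale// L1 mulr1.
  rewrite [leLHS]e1 e2; apply: Lle; [exact: ERlin|exact: ERscale|].
  apply: filterS f1 => x /=; case: (f x) => a b /= ab1; rewrite mulr1.
  have {ab1} ab1 : a ^+ 2 + b ^+ 2 <= 1.
    by move: ab1; rewrite -{1}[1]sqrtr1 ler_sqrt.
  apply: le_trans (ler_norm _) _; rewrite -sqrtr_sqr ler_sqrt; last by rewrite addr_ge0 ?sqr_ge0.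
  apply: (@le_trans _ _ ((p ^+ 2 + q ^+ 2) * (a ^+ 2 + b ^+ 2))).
    rewrite -subr_ge0; rewrite [X in 0 <= X](_ : _ = (p * b - q * a) ^+ 2); first exact: sqr_ge0.
    by ring.
  by rewrite ler_piMr// addr_ge0 ?sqr_ge0.
rewrite /complex_mean /= -/p -/q; set s := Num.sqrt _ in pq *.
have s0 : 0 <= s by exact: sqrtr_ge0.
have s2 : s ^+ 2 = p ^+ 2 + q ^+ 2 by rewrite sqr_sqrtr// addr_ge0 ?sqr_ge0.
by rewrite -s2 in pq; nra.
Qed.

(** Serves twice: for the limit along an ultrafilter, and for the mean transported from the sphere
    to [Linfty]. *)
Lemma mean_of_real : is_mean E F complex_mean.
Proof.
have unit1 : complex_mean (fun=> 1) = 1.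
  by rewrite /complex_mean /= L1 L0.
split => //.
- move=> [a b] f g Ef Eg; have [fr fi] := ERe Ef; have [gr gi] := ERe Eg.
  apply/eqP; rewrite eq_complex /complex_mean; apply/andP; split; apply/eqP => /=.
    rewrite -mulNr -(addrA (a * _)) -!Llin//; last exact: ERlin.
    congr L; apply/funext => x; rewrite addrA mulNr.
    by rewrite [(_ + _) x]/(_ * f x + g x); case: (f x); case: (g x).
  rewrite -(addrA (a * _)) -!Llin//; last exact: ERlin.
  congr L; apply/funext => x; rewrite addrA.
  by rewrite [(_ + _) x]/(_ * f x + g x); case: (f x); case: (g x).
- move=> f g Ef Eg fg; have [fr fi] := ERe Ef; have [gr gi] := ERe Eg.
  rewrite /complex_mean; congr (_ +i* _)%C; apply: Leq => //;
    by apply: filterS fg => x /= ->.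
- move=> f Ef f0; have [fr fi] := ERe Ef; rewrite lecE /=; apply/andP; split.
    apply/eqP; rewrite -[RHS]L0; apply: Leq => //.
    by apply: filterS f0 => x /=; rewrite lecE /= => /andP[/eqP ->].
  apply: Lpos => //.
  by apply: filterS f0 => x /=; rewrite lecE /= => /andP[].
- apply/eqP; rewrite eq_le; apply/andP; split.
    apply: ge_ereal_sup => _ [f [Ef f1] <-]; rewrite lee_fin; exact: norm_le1.
  apply: ereal_sup_ubound; exists (fun=> 1); last by rewrite unit1 Normc.normc1.
  split => //; apply: filterE => x.
  by change (normc 1 <= 1); rewrite Normc.normc1.
Qed.

End mean_of_real.

(** * The walk operator of a finite family and its superharmonic functions *)

Section cayley_walk.
Variables (R : realType) (G : topologicalGroupType).
Implicit Types (s : seq G) (f : G -> R).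

(** The adjacency operator of a Cayley graph, not normalized: its degree is [2 * size s],
    repetitions in [s] counted. Pairing [g] with its inverse makes it symmetric for the [L^2]
    pairing. *)
Definition walk s f (x : G) : R := \sum_(g <- s) (f (g * x)%g + f (g^-1 * x)%g).

Lemma walk_ge0 s f : (forall x, 0 <= f x) -> forall x, 0 <= walk s f x.
Proof. by move=> f0 x; apply: sumr_ge0 => g _; rewrite addr_ge0. Qed.

Lemma iter_walk_ge0 s f n : (forall x, 0 <= f x) -> forall x, 0 <= iter n (walk s) f x.
Proof. by move=> f0; elim: n => //= n IH; exact: walk_ge0. Qed.

Lemma walk_sum s (u : nat -> G -> R) n x :
  walk s (fun y => \sum_(0 <= i < n) u i y) x = \sum_(0 <= i < n) walk s (u i) x.
Proof.
rewrite /walk exchange_big /=; apply: eq_bigr => g _.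
by rewrite big_split.
Qed.

Lemma walkZ s (a : R) f x : walk s (fun y => a * f y) x = a * walk s f x.
Proof. by rewrite /walk mulr_sumr; apply: eq_bigr => g _; rewrite mulrDr. Qed.

Lemma cvg_walk s (u : nat -> G -> R) f x :
  (forall y, u n y @[n --> \oo] --> f y) ->
  walk s (u n) x @[n --> \oo] --> walk s f x.
Proof.
move=> uf; rewrite /walk; apply: cvg_big; [|move=> g _; exact: cvgD].
exact: add_continuous.
Qed.

Lemma measurable_walk s (f : borel G -> R) : measurable_fun [set: borel G] f ->
  measurable_fun [set: borel G] (walk s f : borel G -> R).
Proof.
move=> mf; apply: measurable_sum => g; apply: measurable_funD;
  exact: (measurableT_comp mf (measurable_mulg _)).
Qed.

(* [eta = \sum_n tau ^ n S ^ n D] with [S := walk s] solves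
   [eta = D + tau S eta]. *)
Lemma superharmonic_walk s (D : borel G -> R) (K La tau : R) :
  measurable_fun [set: borel G] D -> (forall x, 0 < D x) ->
  0 <= La -> 0 < tau -> tau * La < 1 ->
  (forall n x, iter n (walk s) D x <= K * La ^+ n) ->
  exists eta : borel G -> R, [/\ measurable_fun [set: borel G] eta,
    forall x, 0 < eta x & forall x, tau * walk s eta x <= eta x].
Proof.
move=> mD D0 La0 tau0 tauLa DK.
pose u n (x : borel G) := tau ^+ n * iter n (walk s) D x.
have u0 n x : 0 <= u n x.
  rewrite mulr_ge0 ?exprn_ge0 ?(ltW tau0)//.
  by apply: iter_walk_ge0 => y; exact: ltW.
pose S n (x : borel G) := \sum_(0 <= i < n) u i x.
have cS x : cvgn (S^~ x).
  (* Comparison with a geometric series of ratio [tau * La < 1]; [K >= 0] comes from the decay bound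
     at [n = 0]. *)
  apply: (@series_le_cvg _ (u^~ x) (geometric K (tau * La))).
  - by move=> n; exact: u0.
  - move=> n /=; rewrite mulr_ge0 ?exprn_ge0 ?mulr_ge0// ?(ltW tau0)//.
    by have := DK 0%N x; rewrite expr0 mulr1; apply: le_trans; exact: ltW.
  - move=> n /=; rewrite /u exprMn mulrCA ler_pM2l ?exprn_gt0//.
  - by apply: is_cvg_geometric_series; rewrite ger0_norm// mulr_ge0// ltW.
pose eta (x : borel G) := limn (S^~ x).
have Seta x : S n x @[n --> \oo] --> eta x by exact: cS.
have SS n x : S n.+1 x = D x + tau * walk s (S n) x.
  rewrite /S big_nat_recl// /u expr0 mul1r walk_sum mulr_sumr; congr (_ + _).
  by apply: eq_bigr => i _ /=; rewrite walkZ mulrA exprS.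
have etaE x : eta x = D x + tau * walk s eta x.
  have c1 : S n.+1 x @[n --> \oo] --> eta x by rewrite (cvg_shiftS (S^~ x)).
  have c2 : S n.+1 x @[n --> \oo] --> D x + tau * walk s eta x.
    under eq_fun do rewrite SS.
    apply: cvgD; first exact: cvg_cst.
    by apply: cvgM; [exact: cvg_cst|exact: cvg_walk].
  exact: (cvg_unique _ c1 c2).
have eta0 x : 0 <= eta x.
  by apply: limr_ge; [exact: cS|apply: nearW => n; exact: sumr_ge0].
exists eta; split.
- apply: (@measurable_fun_cvg _ _ _ _ S) => [n|x _]; last exact: Seta.
  apply: measurable_sum => i; apply: measurable_funM => //.
  by elim: (i) => //= k; exact: measurable_walk.
- move=> x; rewrite etaE; apply: ltr_pwDl => //.
  by rewrite mulr_ge0 ?walk_ge0// ltW.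
- by move=> x; rewrite [leRHS]etaE lerDr ltW.
Qed.

End cayley_walk.

(** * Invariant means on bounded real Borel functions *)

Section real_means.
Variables (R : realType) (G : topologicalGroupType) (mu : left_haar R G).

Definition bounded_borel : set (borel G -> R) :=
  [set f : borel G -> R | measurable_fun [set: borel G] f /\ exists M : R, forall x, `|f x| <= M].

Lemma bounded_borelD f g : bounded_borel f -> bounded_borel g ->
  bounded_borel (fun x => f x + g x).
Proof.
move=> [mf [M fM]] [mg [N gN]]; split; first exact: measurable_funD.
by exists (M + N) => x; apply: le_trans (ler_normD _ _) _; exact: lerD.
Qed.

Lemma bounded_borelN f : bounded_borel f -> bounded_borel (fun x => - f x).
Proof.
move=> [mf [M fM]]; split; first exact: measurable_funN.
by exists M => x; rewrite normrN.
Qed.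

Lemma bounded_borel_cst c : bounded_borel (fun=> c).
Proof. by split; [exact: measurable_cst|exists `|c|]. Qed.

Lemma bounded_borel_mulg f (g : G) : bounded_borel f ->
  bounded_borel (fun x => f (g * x)%g).
Proof.
move=> [mf [M fM]]; split; last by exists M => x.
exact: (measurableT_comp mf (measurable_mulg _)).
Qed.

(** The field [real_mean_le] packs positivity and normalization together; applied to [- f] it yields
    the lower bounds. *)
Record is_real_mean (L : (borel G -> R) -> R) : Prop := IsRealMean {
  real_meanD : forall f g, bounded_borel f -> bounded_borel g ->
    L (fun x => f x + g x) = L f + L g ;
  real_meanN : forall f, bounded_borel f -> L (fun x => - f x) = - L f ;
  real_mean_le : forall f c, bounded_borel f -> (forall x, f x <= c) -> L f <= c ;
  real_mean_mulg : forall (g : G) f, bounded_borel f ->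
    L (fun x => f (g * x)%g) = L f }.

Lemma amenable_real_mean : amenable mu -> exists L, is_real_mean L.
Proof.
move=> [m [mm minv]]; pose cplx (f : borel G -> R) : borel G -> R[i]^o := fun x => (f x)%:C%C.
have LiP f : bounded_borel f -> Linfty mu (cplx f).
  move=> [mf [M fM]]; split; first by split => //; exact: measurable_cst.
  exists M => K _; rewrite (_ : _ `\` _ = set0); first exact: negligible_set0.
  apply/seteqP; split => // x [_ /=]; rewrite /cplx /= => h; apply: h.
  by rewrite expr0n addr0 sqrtr_sqr.
have ReM (a : R) (z : R[i]^o) : complex.Re (a%:C%C * z) = a * complex.Re z.
  by case: z => p q /=; rewrite mul0r subr0.
have lin (a : R) f g : bounded_borel f -> bounded_borel g ->
    complex.Re (m (cplx (fun x => a * f x + g x))) =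
    a * complex.Re (m (cplx f)) + complex.Re (m (cplx g)).
  move=> bf bg; rewrite -ReM -raddfD /= -(mean_linear mm _ (LiP _ bf) (LiP _ bg)).
  congr (complex.Re (m _)); apply/funext => x; rewrite /cplx rmorphD rmorphM //.
have cst c : complex.Re (m (cplx (fun=> c))) = c.
  have h0 : complex.Re (m (cplx (fun=> 0))) = 0.
    have := lin 1 (fun=> 0) (fun=> 0) (bounded_borel_cst _) (bounded_borel_cst _).
    by rewrite !mul1r !addr0; lra.
  have := lin c (fun=> 1) (fun=> 0) (bounded_borel_cst _) (bounded_borel_cst _).
  by rewrite h0 (_ : cplx (fun=> 1) = fun=> 1)// (mean_unit mm)/= !mulr1 !addr0.
exists (fun f => complex.Re (m (cplx f))); split.
- move=> f g bf bg; rewrite -[X in _ = X + _]mul1r -lin//.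
  by congr (complex.Re (m (cplx _))); apply/funext => x; rewrite mul1r.
- move=> f bf; rewrite -[RHS]addr0 -mulN1r -[in RHS](cst 0) -lin//; last exact: bounded_borel_cst.
  by congr (complex.Re (m (cplx _))); apply/funext => x; rewrite mulN1r addr0.
- move=> f c bf fc.
  have b2 : bounded_borel (fun x => -1 * f x + c).
    under eq_fun do rewrite mulN1r.
    by apply: bounded_borelD; [exact: bounded_borelN|exact: bounded_borel_cst].
  have : 0 <= m (cplx (fun x => -1 * f x + c)).
    apply: (mean_positive mm); first exact: LiP.
    move=> K _; rewrite (_ : _ `\` _ = set0); first exact: negligible_set0.
    apply/seteqP; split => // x [_ /=]; rewrite /cplx lecE /= eqxx /= => h; apply: h.
    by rewrite mulN1r addrC subr_ge0.
  rewrite lecE => /andP[_]; rewrite lin//; last exact: bounded_borel_cst.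
  by rewrite cst mulN1r addrC /= subr_ge0.
- by move=> g f bf; rewrite -[in RHS](minv g)//; exact: LiP.
Qed.

End real_means.

(** * An invariant mean excludes decay at a rate below the degree *)

Section mean_decay.
Variables (R : realType) (G : topologicalGroupType).
Variables (L : (borel G -> R) -> R) (LP : is_real_mean L).

(** Each summand is a function minus its translate, on which an invariant mean vanishes. For
    [v g x = ln (eta (g x)) - ln (eta x)], the term [- v g (g^-1 x)] is the logarithmic increment
    along [g^-1], so the sum runs over all the [g] and their inverses. *)
Lemma real_mean_coboundary (s : seq G) (v : G -> borel G -> R) :
  (forall g, g \in s -> bounded_borel (v g)) ->
  bounded_borel (fun x => \sum_(g <- s) (v g x - v g (g^-1 * x)%g)) /\
  L (fun x => \sum_(g <- s) (v g x - v g (g^-1 * x)%g)) = 0.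
Proof.
have c0 := @bounded_borel_cst R G 0.
elim: s => [|g s IH] bv.
  under eq_fun do rewrite big_nil; split => //.
  by apply: (addIr (L (fun=> 0))); rewrite -(real_meanD LP)// !add0r.
under eq_fun do rewrite big_cons.
have [h hs|bs Ls] := IH; first by apply: bv; rewrite inE hs orbT.
have bg : bounded_borel (v g) by apply: bv; rewrite inE eqxx.
have bgN : bounded_borel (fun x => - v g (g^-1 * x)%g).
  exact/bounded_borelN/bounded_borel_mulg.
split; first by apply: bounded_borelD => //; exact: bounded_borelD.
rewrite (real_meanD LP)//; last exact: bounded_borelD.
rewrite Ls addr0 (real_meanD LP)// (real_meanN LP); last exact: bounded_borel_mulg.
by rewrite (real_mean_mulg LP)// subrr.
Qed.

(** A rate [La] below the degree leaves room for a superharmonic [eta]; the sum of its logarithmic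
    increments has mean 0 and yet is bounded above by a negative constant. *)
Lemma mean_no_decay (s : seq G) (D : borel G -> R) (K La : R) :
  measurable_fun [set: borel G] D -> (forall x, 0 < D x) ->
  0 <= La -> La < (size s).*2%:R ->
  (forall n x, iter n (walk s) D x <= K * La ^+ n) -> False.
Proof.
move=> mD D0 La0 LaN DK; set N : R := (size s).*2%:R in LaN.
have N0 : 0 < N by exact: le_lt_trans LaN.
have NLa0 : 0 < N + La by rewrite ltr_wpDr.
(* The inverse of the midpoint of [La] and [N], so that [tau * La < 1 < tau * N]; this choice also
   covers [La = 0]. *)
pose tau := 2 / (N + La).
have tau0 : 0 < tau by rewrite divr_gt0.
have tauLa : tau * La < 1 by rewrite mulrAC ltr_pdivrMr// mul1r; lra.
have tauN : 1 < tau * N by rewrite mulrAC ltr_pdivlMr// mul1r; lra.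
clearbody tau.
have [eta [meta eta0 etaS]] := superharmonic_walk mD D0 La0 tau0 tauLa DK.
(* A Harnack inequality: in the nonnegative sum [walk s eta x <= eta x / tau] every single term
   obeys the bound. Used at [x] and at [g x], it bounds the logarithmic increments on both sides. *)
have step g x : g \in s -> tau * eta (g * x)%g <= eta x /\ tau * eta (g^-1 * x)%g <= eta x.
  move=> gs; have le1 : eta (g * x)%g + eta (g^-1 * x)%g <= walk s eta x.
    rewrite /walk (big_rem g)//= lerDl; apply: sumr_ge0 => h _.
    by rewrite addr_ge0// ltW.
  by have := etaS x; have := eta0 (g * x)%g; have := eta0 (g^-1 * x)%g; split; nra.
pose v g (x : borel G) := ln (eta (g * x)%g) - ln (eta x).
have bv g : g \in s -> bounded_borel (v g).
  move=> gs; split.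
    apply: measurable_funB; apply: measurableT_comp => //.
    exact: (measurableT_comp meta (measurable_mulg _)).
  exists (- ln tau) => x; rewrite ler_norml opprK /v.
  have h1 : ln tau + ln (eta (g * x)%g) <= ln (eta x).
    rewrite -lnM ?posrE// ler_ln ?posrE ?mulr_gt0//.
    exact: (step g x gs).1.
  have h2 : ln tau + ln (eta x) <= ln (eta (g * x)%g).
    rewrite -lnM ?posrE// ler_ln ?posrE ?mulr_gt0//.
    by have := (step g (g * x)%g gs).2; rewrite mulKg.
  by apply/andP; split; lra.
have [bs L0] := real_mean_coboundary bv.
(* The tangent to [ln] at [1 / (tau * N)], which is an upper bound for the average of the [N] ratios
   [eta (g x) / eta x] and [eta (g^-1 x) / eta x]. Summing it replaces Jensen's inequality and gives
   [- N ln (tau * N)]. *)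
have lnle r : 0 < r -> ln r <= tau * N * r - 1 - ln (tau * N).
  move=> r0; have a0 : 0 < tau * N by rewrite mulr_gt0.
  have := @le_ln1Dx _ (tau * N * r - 1); rewrite [1 + _]addrC subrK lnM ?posrE//.
  have : 0 < tau * N * r by rewrite mulr_gt0.
  move=> p /(_ ltac:(lra)); lra.
have lnN : 0 < ln (tau * N) by rewrite ln_gt0.
have : L (fun x => \sum_(g <- s) (v g x - v g (g^-1 * x)%g)) <= - (N * ln (tau * N)).
  apply: (real_mean_le LP) => // x.
  have e0 := eta0 x.
  apply: (@le_trans _ _ (\sum_(g <- s) ((tau * N) * ((eta (g * x)%g + eta (g^-1 * x)%g) / eta x)
      + - (2 * (1 + ln (tau * N)))))).
    apply: ler_sum => g _; rewrite /v mulVKg.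
    have := lnle (eta (g * x)%g / eta x); have := lnle (eta (g^-1 * x)%g / eta x).
    rewrite !divr_gt0// => /(_ isT) h1 /(_ isT) h2.
    rewrite !ln_div ?posrE// in h1 h2; rewrite mulrDl; lra.
  rewrite big_split /= -mulr_sumr -mulr_suml -/(walk s eta x) big_const_seq count_predT iter_addr_0.
  have : walk s eta x / eta x * tau <= 1 by rewrite mulrAC ler_pdivrMr// mul1r mulrC.
  have NE : N = (size s)%:R * 2 by rewrite /N -mul2n natrM mulrC.
  rewrite -[X in _ + X]mulr_natr; move: (walk s eta x / eta x) (ln _) lnN => w l l0 wt.
  have : N * (w * tau) <= N * 1 by rewrite ler_pM2l.
  by rewrite NE; nra.
rewrite L0 => h; have : 0 < N * ln (tau * N) by rewrite mulr_gt0.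
by lra.
Qed.

End mean_decay.

(** * The [L^2] pairing of nonnegative functions *)

Section pairing.
Variables (R : realType) (G : topologicalGroupType) (mu : left_haar R G).
Implicit Types (f h xi zeta : borel G -> R) (s : seq G).

Lemma ge0_integral_mulg (g : G) (f : borel G -> \bar R) :
  measurable_fun [set: borel G] f -> (forall x, 0 <= f x)%E ->
  (\int[mu]_x f (g * x)%g = \int[mu]_x f x)%E.
Proof.
move=> mf f0; have mg := @measurable_mulg G g.
rewrite -[LHS](@ge0_integral_pushforward _ _ _ _ _ _ mg mu setT f)//.
apply: eq_measure_integral => A mA _.
by have := haar_preimage mu g^-1%g mA; rewrite invgK.
Qed.

(** With values in [\bar R], the pairing is additive on nonnegative functions without any
    integrability condition. *)
Definition pairing f h : \bar R := (\int[mu]_x (f x * h x)%:E)%E.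

Definition nonneg_borel : set (borel G -> R) :=
  [set f : borel G -> R | measurable_fun [set: borel G] f /\ forall x, 0 <= f x].

Lemma nonneg_borelD f h : nonneg_borel f -> nonneg_borel h ->
  nonneg_borel (fun x => f x + h x).
Proof.
by move=> [mf f0] [mh h0]; split; [exact: measurable_funD|move=> x; exact: addr_ge0].
Qed.

Lemma nonneg_borelM f h : nonneg_borel f -> nonneg_borel h ->
  nonneg_borel (fun x => f x * h x).
Proof.
by move=> [mf f0] [mh h0]; split; [exact: measurable_funM|move=> x; exact: mulr_ge0].
Qed.

Lemma nonneg_borel_cst (a : R) : 0 <= a -> nonneg_borel (fun=> a).
Proof. by move=> a0; split. Qed.

Lemma nonneg_borel_mulg f (g : G) : nonneg_borel f ->
  nonneg_borel (fun x => f (g * x)%g).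
Proof.
move=> [mf f0]; split => //.
exact: (measurableT_comp mf (measurable_mulg _)).
Qed.

Lemma nonneg_borel_walk s f : nonneg_borel f -> nonneg_borel (walk s f : borel G -> R).
Proof. by move=> [mf f0]; split; [exact: measurable_walk|exact: walk_ge0]. Qed.

Lemma nonneg_borel_iter_walk s f n : nonneg_borel f ->
  nonneg_borel (iter n (walk s) f : borel G -> R).
Proof. by move=> nf; elim: n => //= n; exact: nonneg_borel_walk. Qed.

Let mpair f h : nonneg_borel f -> nonneg_borel h ->
  measurable_fun [set: borel G] (fun x => (f x * h x)%:E).
Proof. by move=> nf nh; apply/measurable_EFinP; exact: (nonneg_borelM nf nh).1. Qed.

Let pair0 f h x : nonneg_borel f -> nonneg_borel h -> (0 <= (f x * h x)%:E)%E.
Proof. by move=> nf nh; rewrite lee_fin; exact: (nonneg_borelM nf nh).2. Qed.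

Lemma pairing_ge0 f h : nonneg_borel f -> nonneg_borel h -> (0 <= pairing f h)%E.
Proof. by move=> nf nh; apply: integral_ge0 => x _; exact: pair0. Qed.

Lemma pairingC f h : pairing f h = pairing h f.
Proof. by apply: eq_integral => x _; rewrite mulrC. Qed.

Lemma pairingDl f1 f2 h : nonneg_borel f1 -> nonneg_borel f2 -> nonneg_borel h ->
  (pairing (fun x => f1 x + f2 x)%R h = pairing f1 h + pairing f2 h)%E.
Proof.
move=> n1 n2 nh; rewrite /pairing -ge0_integralD//; last 4 first.
- by move=> x _; exact: pair0.
- exact: mpair.
- by move=> x _; exact: pair0.
- exact: mpair.
by apply: eq_integral => x _; rewrite mulrDl EFinD.
Qed.

Lemma pairingZl (a : R) f h : 0 <= a -> nonneg_borel f -> nonneg_borel h ->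
  (pairing (fun x => a * f x)%R h = a%:E * pairing f h)%E.
Proof.
move=> a0 nf nh; rewrite /pairing -ge0_integralZl//; last 2 first.
- exact: mpair.
- by move=> x _; exact: pair0.
by apply: eq_integral => x _; rewrite -mulrA EFinM.
Qed.

Lemma le_pairing f1 h1 f2 h2 : nonneg_borel f1 -> nonneg_borel h1 ->
  nonneg_borel f2 -> nonneg_borel h2 -> (forall x, f1 x * h1 x <= f2 x * h2 x) ->
  (pairing f1 h1 <= pairing f2 h2)%E.
Proof.
move=> ? ? ? ? le12; apply: ge0_le_integral => //; last by move=> x _; rewrite lee_fin.
- by move=> x _; exact: pair0.
- exact: mpair.
- exact: mpair.
Qed.

Lemma pairing_mulg (g : G) f h : nonneg_borel f -> nonneg_borel h ->
  pairing (fun x => f (g * x)%g) h = pairing f (fun x => h (g^-1 * x)%g).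
Proof.
move=> nf nh; rewrite /pairing.
rewrite -[RHS](@ge0_integral_mulg g (fun x => (f x * h (g^-1 * x)%g)%:E)).
- by apply: eq_integral => x _; rewrite mulKg.
- by apply: mpair => //; exact: nonneg_borel_mulg.
- by move=> x; apply: (@pair0 f (fun x => h (g^-1 * x)%g)) => //; exact: nonneg_borel_mulg.
Qed.

Lemma pairing_walk s f h : nonneg_borel f -> nonneg_borel h ->
  pairing (walk s f) h = (\sum_(g <- s)
    (pairing (fun x => f (g * x)%g) h + pairing (fun x => f (g^-1 * x)%g) h))%E.
Proof.
move=> nf nh; elim: s => [|g s IH].
  rewrite big_nil /pairing; under eq_integral do rewrite /walk big_nil mul0r.
  by rewrite integral0.
rewrite big_cons -IH -!pairingDl//; last 4 first.
- by apply: nonneg_borelD; exact: nonneg_borel_mulg.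
- exact: nonneg_borel_walk.
- exact: nonneg_borel_mulg.
- exact: nonneg_borel_mulg.
by congr pairing; apply/funext => x; rewrite /walk big_cons.
Qed.

(** Stands in for Cauchy-Schwarz, to be used with a suitable [t]: it integrates
    [0 <= t^-1 (t f - h) ^ 2] and makes sense for infinite values. *)
Lemma pairing_le_sq (t : R) f h : 0 < t -> nonneg_borel f -> nonneg_borel h ->
  (2%:E * pairing f h <= t%:E * pairing f f + t^-1%:E * pairing h h)%E.
Proof.
move=> t0 nf nh; have [_ f0] := nf; have [_ h0] := nh.
have tV0 : 0 < t^-1 by rewrite invr_gt0.
rewrite -!pairingZl ?(ltW t0) ?(ltW tV0)//.
have nt := nonneg_borel_cst (ltW t0).
have nV : nonneg_borel (fun=> t^-1) by apply: nonneg_borel_cst; rewrite invr_ge0 ltW.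
rewrite /pairing -ge0_integralD//; last 4 first.
- by move=> x _; rewrite lee_fin !mulr_ge0// ltW.
- by apply: mpair => //; exact: nonneg_borelM.
- by move=> x _; rewrite lee_fin !mulr_ge0// ltW.
- by apply: mpair => //; exact: nonneg_borelM.
have n2 : nonneg_borel (fun=> 2) by exact: nonneg_borel_cst.
apply: ge0_le_integral => //.
- by move=> x _; rewrite lee_fin !mulr_ge0// ltW.
- by apply: mpair => //; exact: nonneg_borelM.
- by apply: emeasurable_funD; apply: mpair => //; exact: nonneg_borelM.
move=> x _; rewrite -EFinD lee_fin -subr_ge0.
rewrite [X in 0 <= X](_ : _ = t^-1 * (t * f x - h x) ^+ 2).
  by rewrite mulr_ge0 ?sqr_ge0// invr_ge0 ltW.
have ? : t != 0 by rewrite gt_eqF.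
by field.
Qed.

Lemma pairingD f1 h1 f2 h2 : nonneg_borel f1 -> nonneg_borel h1 ->
  nonneg_borel f2 -> nonneg_borel h2 ->
  (pairing f1 h1 + pairing f2 h2 = \int[mu]_x (f1 x * h1 x + f2 x * h2 x)%:E)%E.
Proof.
move=> ? ? ? ?; rewrite /pairing -ge0_integralD//.
- by move=> x _; exact: (@pair0 f1 h1).
- exact: (@mpair f1 h1).
- by move=> x _; exact: (@pair0 f2 h2).
- exact: (@mpair f2 h2).
Qed.

Lemma pairingD_le f1 h1 f2 h2 f3 h3 : nonneg_borel f1 -> nonneg_borel h1 ->
  nonneg_borel f2 -> nonneg_borel h2 -> nonneg_borel f3 -> nonneg_borel h3 ->
  (forall x, f1 x * h1 x + f2 x * h2 x <= f3 x * h3 x) ->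
  (pairing f1 h1 + pairing f2 h2 <= pairing f3 h3)%E.
Proof.
move=> n1 m1 n2 m2 n3 m3 le123; rewrite pairingD//; apply: ge0_le_integral => //.
- move=> x _; rewrite EFinD adde_ge0//; [exact: (@pair0 f1 h1)|exact: (@pair0 f2 h2)].
- apply/measurable_EFinP; apply: measurable_funD; first exact: (nonneg_borelM n1 m1).1.
  exact: (nonneg_borelM n2 m2).1.
- exact: (@mpair f3 h3).
- by move=> x _; rewrite lee_fin.
Qed.

(** Translations preserve [pairing xi xi], and the cross terms of a sum are finite by
    [pairing_le_sq] at [t = 1]. *)
Lemma fin_pairing_walk s xi : nonneg_borel xi -> (pairing xi xi < +oo)%E ->
  (pairing (walk s xi) (walk s xi) < +oo)%E.
Proof.
move=> nx fx; elim: s => [|g r IH].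
  rewrite /pairing; under eq_integral do rewrite /walk big_nil mul0r.
  by rewrite integral0.
have addfin f h : nonneg_borel f -> nonneg_borel h -> (pairing f f < +oo)%E ->
    (pairing h h < +oo)%E ->
    (pairing (fun x => f x + h x)%R (fun x => f x + h x)%R < +oo)%E.
  move=> nf nh ff fh; have nfh := nonneg_borelD nf nh.
  rewrite pairingDl// (pairingC f) (pairingC h) !pairingDl//.
  have fin : (pairing f h < +oo)%E.
    have := pairing_le_sq ltr01 nf nh; rewrite invr1 !mul1e => le2.
    have : (2%:E * pairing f h < +oo)%E by apply: le_lt_trans le2 _; exact: lte_add_pinfty.
    have := pairing_ge0 nf nh; case: (pairing f h) => [q _ _|_|//]; first exact: ltry.
    by rewrite gt0_muley ?lte_fin.
  by rewrite (pairingC h f); apply: lte_add_pinfty; apply: lte_add_pinfty.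
have shift k : (pairing (fun x => xi (k * x)%g) (fun x => xi (k * x)%g) < +oo)%E.
  rewrite pairing_mulg//; last exact: nonneg_borel_mulg.
  have -> // : (fun x : borel G => xi (k * (k^-1 * x))%g) = xi.
  by apply/funext => x; rewrite mulVKg.
have -> : walk (g :: r) xi = fun x => (xi (g * x)%g + xi (g^-1 * x)%g) + walk r xi x.
  by apply/funext => x; rewrite /walk big_cons.
have n1 := nonneg_borel_mulg g nx; have n2 := nonneg_borel_mulg g^-1%g nx.
exact: (addfin _ _ (nonneg_borelD n1 n2) (nonneg_borel_walk r nx)
  (addfin _ _ n1 n2 (shift g) (shift g^-1%g)) IH).
Qed.

(** * From a bound on the quadratic form of the walk to its powers *)

Section spectral_gap.
Variables (s : seq G) (La : R).
Hypothesis La0 : 0 < La.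
(** This says [<S w, w> <= La <w, w>] for [S := walk s]: translations by [g] and [g^-1] are adjoint,
    so both contribute the same amount, whence the factor 2. *)
Hypothesis gap : forall w, nonneg_borel w -> (pairing w w < +oo)%E ->
  (\sum_(g <- s) 2%:E * pairing (fun x => w (g^-1 * x)%g) w <= La%:E * pairing w w)%E.

(* Polarization without signs: the gap is applied to
   [w = sqrt (xi ^ 2 + zeta ^ 2)]. *)
Lemma pairing_walk_gap xi zeta : nonneg_borel xi -> nonneg_borel zeta ->
  (pairing xi xi < +oo)%E -> (pairing zeta zeta < +oo)%E ->
  (2%:E * pairing (walk s xi) zeta <= La%:E * (pairing xi xi + pairing zeta zeta))%E.
Proof.
move=> nx nz fx fz; pose w x := Num.sqrt (xi x ^+ 2 + zeta x ^+ 2).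
have nw : nonneg_borel w.
  split=> [|x]; last exact: sqrtr_ge0.
  apply: (@measurableT_comp _ _ _ _ _ _ (@Num.sqrt R)).
    by apply: continuous_measurable_fun; exact: sqrt_continuous.
  by apply: measurable_funD; apply: measurable_funX; [exact: nx.1|exact: nz.1].
have ww : pairing w w = (pairing xi xi + pairing zeta zeta)%E.
  rewrite pairingD//; apply: eq_integral => x _.
  by rewrite -!expr2 sqr_sqrtr// addr_ge0 ?sqr_ge0.
rewrite -ww; apply: le_trans; last first.
  by apply: gap => //; rewrite ww lte_add_pinfty.
rewrite pairing_walk// ge0_sume_distrr; last first.
  by move=> g _; rewrite adde_ge0 ?pairing_ge0//; exact: nonneg_borel_mulg.
apply: lee_sum => g _; apply: lee_wpmul2l; first by rewrite lee_fin.
rewrite pairing_mulg//.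
have nxg := nonneg_borel_mulg g^-1%g nx; have nzg := nonneg_borel_mulg g^-1%g nz.
have nwg := nonneg_borel_mulg g^-1%g nw.
(* Cauchy-Schwarz in the plane for the vectors [(xi x, zeta x)] and
   [(zeta (g^-1 x), xi (g^-1 x))]. *)
apply: pairingD_le => // x; rewrite /w -sqrtrM ?addr_ge0 ?sqr_ge0//.
apply: le_trans (ler_norm _) _; rewrite -sqrtr_sqr ler_sqrt.
  rewrite -subr_ge0 [X in 0 <= X](_ : _ =
    (xi x * xi (g^-1 * x)%g - zeta x * zeta (g^-1 * x)%g) ^+ 2) ?sqr_ge0//.
  by ring.
by rewrite mulr_ge0// addr_ge0 ?sqr_ge0.
Qed.

(** Take [zeta = La^-1 S xi] in [pairing_walk_gap]: the left side is twice [La^-1 |S xi| ^ 2], and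
    one of the two copies is cancelled by the [zeta] term on the right. *)
Lemma pairing_walk_walk xi : nonneg_borel xi -> (pairing xi xi < +oo)%E ->
  (pairing (walk s xi) (walk s xi) <= (La ^+ 2)%:E * pairing xi xi)%E.
Proof.
move=> nx fx; have fw := fin_pairing_walk s nx fx.
have nw := nonneg_borel_walk s nx.
have LaV : 0 <= La^-1 by rewrite invr_ge0 ltW.
have nz : nonneg_borel (fun x => La^-1 * walk s xi x).
  by apply: nonneg_borelM => //; exact: nonneg_borel_cst.
have zz : (pairing (fun x => La^-1 * walk s xi x)%R (fun x => La^-1 * walk s xi x)%R =
    La^-1%:E * (La^-1%:E * pairing (walk s xi) (walk s xi)))%E.
  by rewrite pairingZl// pairingC pairingZl.
have := @pairing_walk_gap xi (fun x => La^-1 * walk s xi x) nx nz fx.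
rewrite zz pairingC pairingZl//.
have := pairing_ge0 nx nx; have := pairing_ge0 nw nw.
case: (pairing xi xi) fx => // B _; case: (pairing _ _) fw => // A _ A0 B0.
move=> /(_ ltac:(by rewrite -!EFinM ltry)) h; move: h A0 B0.
rewrite -!(EFinM, EFinD) !lee_fin => h A0 B0.
have e1 : La * (La^-1 * A) = A by rewrite mulVKf// gt_eqF.
have e2 : La * (La^-1 * (La^-1 * A)) = La^-1 * A by rewrite mulVKf// gt_eqF.
rewrite mulrDr e2 in h.
have : La^-1 * A <= La * B by lra.
by rewrite ler_pdivrMl// mulrA -expr2.
Qed.

(** Iterating the norm bound gives [|S^n xi| ^ 2 <= La ^ (2 n) |xi| ^ 2]; then [pairing_le_sq] at
    [t = La ^ (- n)] puts the same factor [La ^ n] on both squares. *)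
Lemma pairing_iter_walk xi zeta n : nonneg_borel xi -> nonneg_borel zeta ->
  (pairing xi xi < +oo)%E ->
  (2%:E * pairing (iter n (walk s) xi) zeta <=
   (La ^+ n)%:E * (pairing xi xi + pairing zeta zeta))%E.
Proof.
move=> nx nz fx.
have nn k := nonneg_borel_iter_walk s k nx.
have [fn le_n] : (pairing (iter n (walk s) xi) (iter n (walk s) xi) < +oo)%E /\
    (pairing (iter n (walk s) xi) (iter n (walk s) xi) <= (La ^+ n ^+ 2)%:E * pairing xi xi)%E.
  elim: n => [|n [fn le_n]]; first by split => //; rewrite expr0 expr1n mul1e.
  split; first exact: (fin_pairing_walk s (nn n) fn).
  apply: le_trans (pairing_walk_walk (nn n) fn) _.
  by rewrite [La ^+ n.+1]exprS exprMn [X in (_ <= X * _)%E]EFinM -muleA; apply: lee_wpmul2l => //; rewrite lee_fin sqr_ge0.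
have Ln : 0 < La ^+ n by rewrite exprn_gt0.
have Lni : 0 < (La ^+ n)^-1 by rewrite invr_gt0.
apply: le_trans (pairing_le_sq Lni (nn n) nz) _.
have xx0 := pairing_ge0 nx nx; have zz0 := pairing_ge0 nz nz.
rewrite (@ge0_muleDr _ _ _ _ xx0 zz0) invrK; apply: leeD2r.
apply: le_trans (lee_wpmul2l _ le_n) _; first by rewrite lee_fin ltW.
by rewrite muleA -EFinM expr2 mulKf// gt_eqF.
Qed.

End spectral_gap.

End pairing.

(** * Compact sets and open sigma-compact subgroups *)

Section group_topology.
Variable G : topologicalGroupType.
Implicit Types (A B K U : set G) (x y : G).

Lemma continuous_mulgl x : continuous (fun y : G => (x * y)%g).
Proof.
move=> y; apply: (@continuous_comp _ _ _ (fun y : G => (x, y))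
  (fun y : G * G => (y.1 * y.2)%g)); last exact: mulg_continuous.
by apply: cvg_pair; [exact: cvg_cst|exact: cvg_id].
Qed.

Lemma continuous_mulgr x : continuous (fun y : G => (y * x)%g).
Proof.
move=> y; apply: (@continuous_comp _ _ _ (fun y : G => (y, x))
  (fun y : G * G => (y.1 * y.2)%g)); last exact: mulg_continuous.
by apply: cvg_pair; [exact: cvg_id|exact: cvg_cst].
Qed.

Definition mulset A B : set G := [set (a.1 * a.2)%g | a in A `*` B].

Lemma compact_mulset A B : compact A -> compact B -> compact (mulset A B).
Proof.
move=> cA cB; apply: continuous_compact; last exact: compact_setX.
exact/continuous_subspaceT/mulg_continuous.
Qed.

Lemma compact_translate x K : compact K -> compact [set (x * y)%g | y in K].
Proof.
move=> cK; apply: continuous_compact => //.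
exact/continuous_subspaceT/continuous_mulgl.
Qed.

(** The tube lemma for the multiplication, with compactness in its near-covering form. *)
Lemma open_translate_sub K U : compact K -> open U ->
  open [set x | [set (x * y)%g | y in K] `<=` U].
Proof.
move=> /compact_near_coveringP cK oU; rewrite openE => x /= xKU.
have := @cK G (nbhs x) (fun z y => U (z * y)%g) _.
have h : forall y, K y -> \near y & x, U (x * y)%g.
  move=> y Ky; have : nbhs ((x, y).1 * (x, y).2)%g U.
    by apply: open_nbhs_nbhs; split => //; apply: xKU; exists y.
  move=> /(mulg_continuous (x, y)) /= [[P Q] [/= nP nQ] PQ].
  by exists (Q, P) => //= -[a b] [/= Qa Pb]; exact: (PQ (b, a)).
move=> /(_ _ h); rewrite /interior; apply: filterS => z /= zKU _ [y Ky <-].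
exact: zKU.
Qed.

Fixpoint word_set B n : set G :=
  if n is n'.+1 then mulset B (word_set B n') else [set 1%g].

(** For [B] closed under inversion this is the subgroup generated by [B]; it is sigma-compact if [B]
    is compact, and open if [B] is a neighbourhood of 1. *)
Definition generated B : set G := \bigcup_n word_set B n.

Lemma compact_word_set B n : compact B -> compact (word_set B n).
Proof.
by move=> cB; elim: n => [|n IH] /=; [exact: compact_set1|exact: compact_mulset].
Qed.

Lemma generated1 B : generated B 1%g. Proof. by exists 0%N. Qed.

Lemma generated_mull B x y : B x -> generated B y -> generated B (x * y)%g.
Proof. by move=> Bx [n _ yn]; exists n.+1 => //; exists (x, y). Qed.

Lemma generated_mul B x y : generated B x -> generated B y -> generated B (x * y)%g.
Proof.
move=> [n _]; elim: n x => [|n IH] x /=; first by move=> ->; rewrite mul1g.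
by move=> [[b a] [/= Bb an] <-] gy; rewrite -mulgA; apply: generated_mull => //; exact: IH.
Qed.

Lemma sub_generated B : B `<=` generated B.
Proof. by move=> x Bx; rewrite -[x]mulg1; apply: generated_mull => //; exact: generated1. Qed.

Lemma generated_inv B x : (forall b, B b -> B b^-1%g) -> generated B x ->
  generated B x^-1%g.
Proof.
move=> symB [n _]; elim: n x => [|n IH] x /=.
  by move=> ->; rewrite invg1; exact: generated1.
move=> [[b a] [/= Bb an] <-]; rewrite invgM; apply: generated_mul; first exact: IH.
exact/sub_generated/symB.
Qed.

Lemma compact_generating_set K (s : seq G) : locally_compact [set: G] -> compact K ->
  exists B : set G, [/\ compact B, nbhs 1%g B, forall b, B b -> B b^-1%g,
    K `<=` B & forall g, g \in s -> B g].
Proof.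
move=> /(_ 1%g I) [W nW [cW _]] cK.
have {}nW : nbhs 1%g W by move: nW; rewrite /within /=; apply: filterS => x; apply.
have cs : compact [set` s].
  by apply: finite_compact; exact: finite_seq.
pose C := W `|` K `|` [set` s].
have cC : compact C by apply: compactU => //; exact: compactU.
have cCi : compact [set x^-1%g | x in C].
  by apply: continuous_compact => //; exact/continuous_subspaceT/invg_continuous.
exists (C `|` [set x^-1%g | x in C]); split.
- exact: compactU.
- by apply: filterS nW => x Wx; left; left; left.
- by move=> b [Cb|[x Cx <-]]; [right; exists b|left; rewrite invgK].
- by move=> x Kx; left; left; right.
- by move=> g gs; left; right.
Qed.

End group_topology.

(** * Retraction of the group onto an open subgroup *)

Section coset_representative.
Variables (G : topologicalGroupType) (B : set G).
Hypothesis B1 : nbhs 1%g B.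
Hypothesis symB : forall b, B b -> B b^-1%g.

(* The [H]-component of [x] in [G = \bigcup_i H x_i], where the right cosets of
   the open subgroup [H] generated by [B] are disjoint and open. *)
Definition coset_part (x : G) : G :=
  (x * (xget 1 [set y | generated B (y * x^-1)])^-1)%g.

Lemma generated_coset_part x : generated B (coset_part x).
Proof.
(* The default value of [xget] never occurs, since [x] lies in its own coset. *)
rewrite /coset_part; case: xgetP => [y _ /= Hy|/(_ x)].
  by rewrite -[x]invgK -invgM; exact: generated_inv.
by rewrite /= mulgV => /(_ (@generated1 G B)).
Qed.

(** The right cosets of [h x] and of [x] are the same set, so [xget] chooses the same representative
    for both. *)
Lemma coset_partM h x : generated B h -> coset_part (h * x)%g = (h * coset_part x)%g.
Proof.
move=> Hh; rewrite /coset_part -mulgA; congr (_ * (_ * (xget _ _)^-1))%g.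
apply/seteqP; split => y /=; rewrite invgM mulgA => Hy.
  by rewrite -[(_ * _)%g](mulgVK h); exact: generated_mul.
by apply: generated_mul => //; exact: generated_inv.
Qed.

(** On the neighbourhood [B x] of [x], [coset_part] is the right multiplication by the constant
    [x^-1 * coset_part x]. *)
Lemma open_coset_part (U : set G) : open U -> open (coset_part @^-1` U).
Proof.
rewrite !openE => oU x /= Ux; rewrite /interior.
have h : nbhs x [set z | B (z * x^-1)%g].
  have := @continuous_mulgr G x^-1%g x B; rewrite /= mulgV => /(_ B1).
  by [].
have := @continuous_mulgr G (x^-1 * coset_part x)%g x U.
rewrite /= mulVKg => /(_ (oU _ Ux)) h2.
near=> z.
have zx : B (z * x^-1)%g by near: z; exact: h.
have Uz : U (z * (x^-1 * coset_part x))%g by near: z; exact: h2.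
rewrite -[z](mulgVK x) /= coset_partM; last exact: sub_generated.
by rewrite -mulgA.
Unshelve. all: by end_near. Qed.

End coset_representative.

(** * Measurability, and a weight positive on a sigma-compact subgroup *)

Section haar_construction.
Variables (R : realType) (G : topologicalGroupType) (mu : left_haar R G).
Hypothesis hausdorffG : hausdorff_space G.

Lemma open_measurable_borel (U : set G) : open U -> measurable (U : set (borel G)).
Proof. by move=> oU; apply: sub_sigma_algebra. Qed.

Lemma compact_measurable_borel (K : set G) : compact K -> measurable (K : set (borel G)).
Proof.
move=> cK; rewrite -[K](setCK K); apply: measurableC; apply: open_measurable_borel.
by apply: closed_openC; exact: compact_closed.
Qed.

Lemma usc_measurable_borel (f : borel G -> R) :
  (forall a, open ([set x | f x < a] : set G)) -> measurable_fun [set: borel G] f.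
Proof.
move=> of_; apply: (measurability _ (RGenInftyO.measurableE R)) => //.
move=> _ [_ [a ->] <-]; rewrite setTI; apply: open_measurable_borel.
by rewrite (_ : _ @^-1` _ = [set x | f x < a]).
Qed.

Lemma haar_translate (g : G) (A : set (borel G)) : measurable A ->
  mu [set (g * x)%g | x in A] = mu A.
Proof. exact: (haar_invariant (haarP mu)). Qed.

Lemma exists_compact_gt0 : exists2 K : set G, compact K & (0 < mu K)%E.
Proof.
have : (0 < mu [set: borel G])%E.
  by rewrite lt0e (haar_neq0 (haarP mu)) measure_ge0.
rewrite (haar_inner (haarP mu) (@openT G)) => /ereal_sup_gt[_ [K [cK _] <-] K0].
by exists K.
Qed.

(** The weight is a series of multiples of the indicators of the compact sets [word_set B n], which
    exhaust [generated B]. As [xi <= 1], [xi ^ 2 <= xi] and integrability suffices. *)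
Lemma exists_weight (B : set G) : compact B -> exists xi : borel G -> R,
  [/\ nonneg_borel xi, forall x, xi x <= 1, (pairing mu xi xi < +oo)%E
    & forall x, generated B x -> 0 < xi x].
Proof.
move=> cB; pose C n : set (borel G) := word_set B n.
have mC n : measurable (C n) by apply: compact_measurable_borel; exact: compact_word_set.
have Cfin n : (mu (C n) < +oo)%E by apply: (haar_compact (haarP mu)); exact: compact_word_set.
pose M n := fine (mu (C n)).
have muC n : mu (C n) = (M n)%:E by rewrite fineK// ge0_fin_numE.
have M0 n : 0 <= M n by rewrite fine_ge0.
(* Both [a n] and [a n * mu (C n)] are at most [2 ^ (- (n + 1))], so the series and its integral are
   both bounded by 1. *)
pose a n : R := 1 / (2 ^ n.+1)%:R / (1 + M n).
have a0 n : 0 < a n by rewrite !divr_gt0// ?ltr0n ?expn_gt0// ltr_wpDr.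
have al n : a n * (1 + M n) = 1 / (2 ^ n.+1)%:R.
  by rewrite /a divfK// gt_eqF// ltr_wpDr.
pose xiE (x : borel G) := (\sum_(n <oo) (a n * \1_(C n) x)%:E)%E.
have t0 n x : 0 <= a n * \1_(C n) x by rewrite mulr_ge0// ltW.
have mt n : measurable_fun [set: borel G] (fun x => a n * \1_(C n) x).
  by apply: measurable_funM => //; exact: measurable_indic.
have mxiE : measurable_fun [set: borel G] xiE.
  apply: (ge0_emeasurable_sum (P := xpredT)) => [n x _ _|n _].
    by rewrite lee_fin.
  exact/measurable_EFinP.
have xiE0 x : (0 <= xiE x)%E by apply: nneseries_ge0 => n _ _; rewrite lee_fin.
have xiE1 x : (xiE x <= 1)%E.
  apply: le_trans (epsilon_trick0 xpredT ler01).
  apply: lee_nneseries => n _; first by rewrite lee_fin.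
  rewrite lee_fin -al; apply: ler_pM => //; [exact: ltW|].
  by rewrite indicE; case: (_ \in _); rewrite ?lerDl// addr_ge0.
have fxi x : (fine (xiE x))%:E = xiE x.
  by rewrite fineK// ge0_fin_numE// (le_lt_trans (xiE1 x))// ltry.
have nxi : nonneg_borel (fine \o xiE : borel G -> R).
  split; last by move=> x; exact: fine_ge0.
  by apply: measurableT_comp mxiE.
have le1 x : fine (xiE x) <= 1 by rewrite -lee_fin fxi.
exists (fine \o xiE); split => //.
- apply: (@le_lt_trans _ _ (\int[mu]_x xiE x)%E); last first.
    rewrite integral_nneseries//; last 2 first.
    - by move=> n; exact/measurable_EFinP.
    - by move=> n x _; rewrite lee_fin.
    apply: (@le_lt_trans _ _ 1%E); last by rewrite ltry.
    apply: le_trans (epsilon_trick0 xpredT ler01).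
    apply: lee_nneseries => n _.
      by move=> _; apply: integral_ge0 => x _; rewrite lee_fin.
    under eq_integral do rewrite EFinM.
    have mi : measurable_fun [set: borel G] (fun x => (\1_(C n) x)%:E : \bar R).
      by apply/measurable_EFinP; exact: measurable_indic.
    have an : (0 <= (a n)%:E)%E by rewrite lee_fin ltW.
    rewrite (ge0_integralZl mu measurableT mi)//.
    rewrite integral_indic// setIT muC -EFinM lee_fin -al.
    by rewrite ler_pM2l// lerDr.
  apply: ge0_le_integral => //.
  + by move=> x _; rewrite lee_fin mulr_ge0 ?nxi.2.
  + by apply/measurable_EFinP; exact: (nonneg_borelM nxi nxi).1.
  + by move=> x _; rewrite -[leRHS]fxi lee_fin; apply: ler_piMl; [exact: nxi.2|exact: le1].
- move=> x [n _ Cx]; rewrite -lte_fin [ltRHS]fxi.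
  apply: (@lt_le_trans _ _ (a n * \1_(C n) x)%:E).
    by rewrite lte_fin indicE mem_set// mulr1.
  (* The partial sum of the first [n.+1] terms is the first to include the term of index [n]. *)
  apply: le_trans (nneseries_lim_ge n.+1 _); last by move=> k _ _; rewrite lee_fin.
  rewrite big_nat_recr//= leeDr//.
  by apply: sume_ge0 => k _; rewrite lee_fin.
Qed.

End haar_construction.

(** * A positive matrix coefficient with exponential decay *)

Section decaying_function.
Variables (R : realType) (G : topologicalGroupType) (mu : left_haar R G).
Hypothesis hausdorffG : hausdorff_space G.
Variables (K : set G) (xi : borel G -> R).
Hypotheses (cK : compact K) (nxi : nonneg_borel xi) (xi1 : forall x, xi x <= 1).

(** The matrix coefficient [<f, x 1_K>] of the regular representation, that is, the integral of [f]
    over [x K]. *)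
Definition correlation (f : borel G -> R) (x : G) : R :=
  fine (pairing mu f (fun y => \1_(K : set (borel G)) (x^-1 * y)%g)).

Let mK : measurable (K : set (borel G)). Proof. exact: compact_measurable_borel. Qed.

Let translateK x : (fun y : borel G => \1_(K : set (borel G)) (x^-1 * y)%g) =
  \1_([set (x * y)%g | y in K] : set (borel G)) :> (borel G -> R).
Proof.
apply/funext => y; rewrite !indicE; congr (nat_of_bool _)%:R.
apply/idP/idP => /set_mem h; apply/mem_set.
  by exists (x^-1 * y)%g; rewrite ?mulVKg.
by case: h => z Kz <-; rewrite mulKg.
Qed.

Lemma nonneg_borel_indic (A : set (borel G)) : measurable A ->
  nonneg_borel (\1_A : borel G -> R).
Proof. by move=> mA; split => //; exact: measurable_indic. Qed.

Lemma pairing_indic (A : set (borel G)) : measurable A ->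
  pairing mu (\1_A) (\1_A) = mu A.
Proof.
move=> mA; rewrite -[A in RHS]setIT -integral_indic//; apply: eq_integral => x _.
by rewrite indicE; case: (_ \in _); rewrite ?mul1r ?mul0r.
Qed.

Let mtK x : measurable ([set (x * y)%g | y in K] : set (borel G)).
Proof. by apply: compact_measurable_borel => //; exact: compact_translate. Qed.

Let muK : (mu K < +oo)%E. Proof. exact: (haar_compact (haarP mu)). Qed.

Let mutK x : mu [set (x * y)%g | y in K] = mu K.
Proof. exact: haar_translate. Qed.

Let nIK x : nonneg_borel (fun y : borel G => \1_(K : set (borel G)) (x^-1 * y)%g : R).
Proof. by rewrite translateK; exact: nonneg_borel_indic. Qed.

Let pIK x : pairing mu (fun y : borel G => \1_(K : set (borel G)) (x^-1 * y)%g)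
  (fun y : borel G => \1_(K : set (borel G)) (x^-1 * y)%g) = mu K.
Proof. by rewrite translateK pairing_indic. Qed.

Lemma correlationE f x : nonneg_borel f -> (pairing mu f f < +oo)%E ->
  (correlation f x)%:E = pairing mu f (fun y => \1_(K : set (borel G)) (x^-1 * y)%g).
Proof.
move=> nf ff; rewrite /correlation fineK// ge0_fin_numE; last exact: pairing_ge0.
have := pairing_le_sq mu ltr01 nf (nIK x); rewrite invr1 !mul1e pIK => le2.
have : (2%:E * pairing mu f (fun y => \1_(K : set (borel G)) (x^-1 * y)%g) < +oo)%E.
  by apply: le_lt_trans le2 _; exact: lte_add_pinfty.
have := pairing_ge0 mu nf (nIK x).
case: (pairing mu f _) => [q _ _|_|//]; first exact: ltry.
by rewrite gt0_muley ?lte_fin.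
Qed.

(** By invariance, replacing [f] by [f (g y)] amounts to replacing [x] by [g x]: [correlation]
    intertwines the walk on square-integrable functions with the walk on pointwise values. *)
Lemma correlation_walk (s : seq G) f x : nonneg_borel f -> (pairing mu f f < +oo)%E ->
  correlation (walk s f) x = walk s (correlation f) x.
Proof.
move=> nf ff; apply: EFin_inj; rewrite correlationE; last 2 first.
- exact: nonneg_borel_walk.
- exact: fin_pairing_walk.
rewrite pairing_walk// /walk -sumEFin; apply: eq_bigr => g _.
rewrite EFinD !correlationE// !pairing_mulg//.
by congr (pairing mu f _ + pairing mu f _)%E; apply/funext => y;
  rewrite invgM -mulgA ?invgK.
Qed.

Hypothesis fxi : (pairing mu xi xi < +oo)%E.

Let fin_iter (s : seq G) n :
  (pairing mu (iter n (walk s) xi) (iter n (walk s) xi) < +oo)%E.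
Proof.
elim: n => // n IH; exact: (fin_pairing_walk s (nonneg_borel_iter_walk s n nxi) IH).
Qed.

Lemma correlation_iter_walk (s : seq G) n x :
  iter n (walk s) (correlation xi) x = correlation (iter n (walk s) xi) x.
Proof.
elim: n x => // n IH x; rewrite !iterS correlation_walk//.
  by rewrite (_ : iter n _ _ = correlation (iter n (walk s) xi))//; apply/funext.
exact: nonneg_borel_iter_walk.
Qed.

(** The bound is uniform in [x] because [x 1_K] has squared norm [mu K] for every [x]. This turns an
    [L^2] estimate into a pointwise one. *)
Lemma correlation_decay (s : seq G) La : 0 < La ->
  (forall w, nonneg_borel w -> (pairing mu w w < +oo)%E ->
    (\sum_(g <- s) 2%:E * pairing mu (fun x => w (g^-1 * x)%g) w <=
     La%:E * pairing mu w w)%E) ->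
  forall n x, iter n (walk s) (correlation xi) x <=
    fine (pairing mu xi xi + mu K) * La ^+ n.
Proof.
move=> La0 gap n x; rewrite correlation_iter_walk.
have fin : (pairing mu xi xi + mu K < +oo)%E by exact: lte_add_pinfty.
have pos : (0 <= pairing mu xi xi + mu K)%E by rewrite adde_ge0//; exact: pairing_ge0.
have fe : (fine (pairing mu xi xi + mu K))%:E = (pairing mu xi xi + mu K)%E.
  by rewrite fineK// ge0_fin_numE.
have := pairing_iter_walk La0 gap n nxi (nIK x) fxi.
have nn := nonneg_borel_iter_walk s n nxi.
have fn := fin_iter s n.
rewrite pIK -fe -correlationE// -!EFinM lee_fin mulrC.
have : 0 <= correlation (iter n (walk s) xi) x.
  by rewrite /correlation fine_ge0//; exact: pairing_ge0.
by rewrite [X in _ -> _ <= X -> _]mulrC; lra.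
Qed.

(** Upper semicontinuity, which yields Borel measurability. Outer regularity gives an open [U]
    around [x K] with [mu (U \ x K)] less than the available margin [d]; for [z] near [x], [z K]
    stays in [U], and [xi <= 1] bounds the excess of the integral by that measure. *)
Lemma open_correlation_lt a : open ([set x | correlation xi x < a] : set G).
Proof.
rewrite openE => x /= xa.
pose d := a - correlation xi x.
have d0 : 0 < d by rewrite subr_gt0.
have finK : mu K \is a fin_num by rewrite ge0_fin_numE.
have : (mu [set (x * y)%g | y in K] < mu K + d%:E)%E.
  by rewrite mutK lteDl// lte_fin.
rewrite (haar_outer (haarP mu) (mtK x)) => /ereal_inf_lt[_ [U [oU KU] <-] Ud].
have mU := open_measurable_borel oU.
have := open_translate_sub cK oU; rewrite openE => /(_ x KU).
apply: filterS => z /= zKU.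
set A := [set (x * y)%g | y in K] in KU *.
have mA : measurable (A : set (borel G)) by exact: mtK.
have mD : measurable ((U : set (borel G)) `\` A) by exact: measurableD.
have muD : (mu (U `\` A) < d%:E)%E.
  have e : (mu U = mu K + mu (U `\` A))%E.
    by rewrite -(mutK x) -measureU ?setDUK// setDIK.
  by rewrite e lteD2lE in Ud.
have nA := nonneg_borel_indic mA; have nD := nonneg_borel_indic mD.
have nz := nonneg_borel_indic (mtK z).
rewrite -lte_fin correlationE// translateK.
have nAD := nonneg_borelD nA nD.
apply: (@le_lt_trans _ _ (pairing mu xi (fun y => \1_A y + \1_(U `\` A) y))).
  apply: le_pairing => // y; apply: ler_wpM2l; first exact: nxi.2.
  rewrite !indicE; have [/set_mem yz|//] := boolP (y \in _); last first.
    by rewrite addr_ge0.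
  have [yA|/negP yA] := boolP (y \in A); first by rewrite lerDl.
  rewrite add0r mem_set//; split; first exact: zKU.
  by move=> h; apply: yA; exact: mem_set.
rewrite pairingC pairingDl// ![pairing mu (\1_ _) xi]pairingC -translateK -correlationE//.
have -> : a%:E = ((correlation xi x)%:E + d%:E)%E by rewrite -EFinD addrC subrK.
rewrite lteD2lE//.
apply: le_lt_trans muD; rewrite -pairing_indic//; apply: le_pairing => // y.
by rewrite indicE; case: (_ \in _); rewrite ?mulr1 ?mulr0.
Qed.

(** A zero integral would make [xi] vanish almost everywhere on [x K]; but [x K] lies in the
    subgroup, where [xi > 0], and has measure [mu K > 0]. *)
Lemma correlation_gt0 (B : set G) x : (0 < mu K)%E ->
  (forall z, generated B z -> 0 < xi z) -> K `<=` B -> generated B x ->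
  0 < correlation xi x.
Proof.
move=> K0 xiB KB Bx; rewrite -lte_fin correlationE// lt0e pairing_ge0// andbT.
apply/eqP => p0; have := K0; rewrite -(mutK x) (_ : mu _ = 0%E) ?ltxx//.
apply: measure_negligible; first exact: mtK.
have nx := nIK x.
pose f (y : borel G) : \bar R := (xi y * \1_(K : set (borel G)) (x^-1 * y)%g)%:E.
have mf : measurable_fun [set: borel G] f.
  by apply/measurable_EFinP; exact: (nonneg_borelM nxi nx).1.
have : (\int[mu]_y `|f y| = 0)%E.
  rewrite -[RHS]p0; apply: eq_integral => y _.
  by rewrite gee0_abs// lee_fin; exact: (nonneg_borelM nxi nx).2.
move=> /(ae_eq_integral_abs mu measurableT mf); apply: negligibleS => _ [z Kz <-] /= /(_ I).
rewrite /f mulKg indicE mem_set// mulr1 => -[] /eqP; rewrite gt_eqF//.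
by apply: xiB; apply: generated_mul => //; exact/sub_generated/KB.
Qed.

End decaying_function.

(** * Squared [L^2] norms as integrals *)

Section L2_facts.
Context d (T : measurableType d) (R : realType).
Variable mu : {measure set T -> \bar R}.

Lemma L2integralE (h : T -> R) : (forall x, 0 <= h x) ->
  (\int[mu]_x (`|(EFin \o h) x| `^ 2) = \int[mu]_x (h x ^+ 2)%:E)%E.
Proof.
move=> h0; apply: eq_integral => x _ /=.
by rewrite ger0_norm// powR_mulrn.
Qed.

Lemma cabs_ge0 (f : T -> R[i]) x : 0 <= cabs f x.
Proof. by rewrite /cabs; case: (f x) => a b; exact: sqrtr_ge0. Qed.

Lemma L2seminorm_ge0 (f : T -> R[i]) : 0 <= L2seminorm mu f.
Proof. by rewrite /L2seminorm fine_ge0// Lnorm_ge0. Qed.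

Lemma L2seminorm_sq (f : L2fun mu) :
  (L2seminorm mu f ^+ 2)%:E = (\int[mu]_x (cabs f x ^+ 2)%:E)%E.
Proof.
rewrite -powR_mulrn ?L2seminorm_ge0// -poweR_EFin L2seminormE Lnorm2E -poweRrM.
rewrite mulVf// poweRe1; last by apply: integral_ge0 => x _; exact: poweR_ge0.
by rewrite L2integralE//; exact: cabs_ge0.
Qed.

Lemma L2pred_nonneg (w : T -> R) : measurable_fun [set: T] w -> (forall x, 0 <= w x) ->
  (\int[mu]_x (w x ^+ 2)%:E < +oo)%E -> (fun x => (w x)%:C%C) \in @L2pred _ _ _ mu.
Proof.
move=> mw w0 fw; apply/asboolP; split; first by split => //; exact: measurable_cst.
rewrite /finite_norm Lnorm2E (_ : cabs _ = w); last first.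
  by apply/funext => x; rewrite /cabs /= expr0n addr0 sqrtr_sqr ger0_norm.
by rewrite L2integralE//; exact: poweR_lty.
Qed.

End L2_facts.

(** * Amenability yields almost invariant unit vectors *)

Section almost_invariant_vectors.
Variables (R : realType) (G : topologicalGroupType) (mu : left_haar R G).
Local Open Scope quotient_scope.

Definition almost_invariant := forall (s : seq G) (e : R), 0 < e ->
  exists2 u : L2 mu, `|u| = 1 & forall g, g \in s -> `|left_regular g u - u| < e%:C%C.

Lemma pi_L2B (f h : L2fun mu) :
  \pi_(L2 mu) f - \pi_(L2 mu) h = \pi_(L2 mu) (f - h).
Proof. by rewrite [RHS]Quotient.pi_add Quotient.pi_opp. Qed.

Lemma pairing_mulg_le (g : G) w : nonneg_borel w ->
  (2%:E * pairing mu (fun x => w (g * x)%g) w <= 2%:E * pairing mu w w)%E.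
Proof.
move=> nw; have ng := nonneg_borel_mulg g nw.
apply: le_trans (pairing_le_sq mu ltr01 ng nw) _.
rewrite invr1 !mul1e pairing_mulg//.
have -> : (fun x : borel G => w (g * (g^-1 * x))%g) = w by apply/funext => x; rewrite mulVKg.
by rewrite mule_natl mule2n.
Qed.

(* Polarization: [2 <g w, w> = 2 - |g w - w| ^ 2] for a unit vector [w]. *)
Lemma unit_pairing_le (g : G) (e : R) (w : borel G -> R) (f : L2fun mu) : 0 <= e ->
  nonneg_borel w -> pairing mu w w = 1%E -> (forall x, f x = (w x)%:C%C) ->
  e%:C%C <= `|left_regular g (\pi_(L2 mu) f) - \pi_(L2 mu) f| ->
  (2%:E * pairing mu (fun x => w (g^-1 * x)%g) w <= (2 - e ^+ 2)%:E)%E.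
Proof.
move=> e0 nw w1 fE; rewrite left_regular_pi pi_L2B.
rewrite [X in _ <= X -> _]/(L2norm _) /L2norm L2seminorm_pi lecR => le_e.
have ng := nonneg_borel_mulg g^-1%g nw.
pose k (x : borel G) : R := `|w (g^-1 * x)%g - w x|.
have nk : nonneg_borel k.
  split=> [|x]; last exact: normr_ge0.
  by apply: measurableT_comp => //; apply: measurable_funB; [exact: ng.1|exact: nw.1].
have kk : (L2seminorm mu (L2translate g f - f : L2fun mu) ^+ 2)%:E = pairing mu k k.
  rewrite L2seminorm_sq; apply: eq_integral => x _; congr EFin.
  rewrite /cabs [(L2translate g f - f : L2fun mu) x]/(f (g^-1 * x)%g - f x) !fE /=.
  by rewrite oppr0 addr0 expr0n addr0 sqrtr_sqr expr2.
have ee : ((e ^+ 2)%:E <= pairing mu k k)%E.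
  by rewrite -kk lee_fin lerXn2r// nnegrE L2seminorm_ge0.
have tot : (2%:E * pairing mu (fun x => w (g^-1 * x)%g) w + pairing mu k k <= 2%:E)%E.
  have e2 : 2%:E = (pairing mu (fun x => w (g^-1 * x)%g) (fun x => w (g^-1 * x)%g) + pairing mu w w)%E.
    have -> : pairing mu (fun x => w (g^-1 * x)%g) (fun x => w (g^-1 * x)%g) = 1%E.
      rewrite pairing_mulg// -w1; congr pairing.
      by apply/funext => x; rewrite mulVKg.
    by rewrite w1 -EFinD.
  have n2 := nonneg_borel_cst G (ler0n R 2).
  have n2w : nonneg_borel (fun x => 2 * w (g^-1 * x)%g) by exact: nonneg_borelM.
  rewrite [leRHS]e2 -pairingZl// (pairingD mu n2w nw nk nk) (pairingD mu ng ng nw nw).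
  rewrite le_eqVlt; apply/orP; left; apply/eqP; apply: eq_integral => x _.
  by congr EFin; rewrite /k -expr2 real_normK ?num_real//; ring.
have : (2%:E * pairing mu (fun x => w (g^-1 * x)%g) w + (e ^+ 2)%:E <= 2%:E)%E.
  by apply: le_trans tot; exact: leeD2l.
by rewrite EFinB leeBrDr.
Qed.

(** Normalize [w]. Some [g] in [s] moves the resulting unit vector by at least [e], which saves
    [e ^ 2] in its term; every other term has the trivial bound [2 |w| ^ 2]. *)
Lemma spectral_gap_of (s : seq G) (e : R) : 0 < e ->
  (forall u : L2 mu, `|u| = 1 -> exists2 g, g \in s & e%:C%C <= `|left_regular g u - u|) ->
  forall w, nonneg_borel w -> (pairing mu w w < +oo)%E ->
    (\sum_(g <- s) 2%:E * pairing mu (fun x => w (g^-1 * x)%g) w <=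
     ((size s).*2%:R - e ^+ 2)%:E * pairing mu w w)%E.
Proof.
move=> e0 gap w nw fw.
have ww0 := pairing_ge0 mu nw nw.
pose B := fine (pairing mu w w).
have BE : pairing mu w w = B%:E by rewrite fineK// ge0_fin_numE.
have B0 : 0 <= B by rewrite -lee_fin -BE.
have ng g := nonneg_borel_mulg g nw.
pose P g := fine (pairing mu (fun x => w (g^-1 * x)%g) w).
have le2 g := pairing_mulg_le g^-1%g nw.
have PE g : pairing mu (fun x => w (g^-1 * x)%g) w = (P g)%:E.
  rewrite fineK// ge0_fin_numE; last exact: pairing_ge0.
  have := le2 g; rewrite BE; have := pairing_ge0 mu (ng g^-1%g) nw.
  case: (pairing mu _ w) => [q _ _|_|//]; first exact: ltry.
  by rewrite gt0_muley ?lte_fin// leye_eq.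
have Ple g : 2 * P g <= 2 * B by have := le2 g; rewrite PE BE -!EFinM lee_fin.
under eq_bigr do rewrite PE -EFinM.
rewrite sumEFin BE -EFinM lee_fin.
have sumle r : \sum_(g <- r) 2 * P g <= (size r).*2%:R * B.
  apply: (@le_trans _ _ (\sum_(g <- r) 2 * B)); first by apply: ler_sum => g _; exact: Ple.
  by rewrite big_const_seq count_predT iter_addr_0 -mulr_natr -mul2n natrM; lra.
have [B1|Bpos] := eqVneq B 0.
  by have := sumle s; rewrite B1 !mulr0.
have {}Bpos : 0 < B by rewrite lt0r Bpos.
pose b := (Num.sqrt B)^-1.
have b0 : 0 <= b by rewrite invr_ge0 sqrtr_ge0.
have bbB : b * b * B = 1.
  by rewrite -expr2 exprVn sqr_sqrtr ?(ltW Bpos)// mulVf// gt_eqF.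
have nb := nonneg_borel_cst G b0.
pose v x := b * w x.
have nv : nonneg_borel v by exact: nonneg_borelM.
have vv : pairing mu v v = 1%E.
  by rewrite pairingZl// pairingC pairingZl// BE -!EFinM mulrA bbB.
have Lv : (fun x => (v x)%:C%C) \in @L2pred _ _ _ mu.
  apply: L2pred_nonneg; [exact: nv.1|exact: nv.2|].
  rewrite (_ : (\int[mu]_x _)%E = pairing mu v v) ?vv ?ltry//.
have norm1 : `|\pi_(L2 mu) (L2Fun Lv)| = 1.
  rewrite [LHS]/(L2norm _) /L2norm L2seminorm_pi.
  have : (L2seminorm mu (L2Fun Lv) ^+ 2)%:E = 1%E.
    rewrite L2seminorm_sq -vv; apply: eq_integral => x _; congr EFin.
    by rewrite /cabs /= expr0n addr0 sqrtr_sqr ger0_norm ?expr2//; exact: nv.2.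
  move=> -[] /eqP; rewrite sqrp_eq1 ?L2seminorm_ge0// => /eqP ->.
  by [].
have [g gs le_e] := gap _ norm1.
have := @unit_pairing_le g e v (L2Fun Lv) (ltW e0) nv vv (fun x => erefl) le_e.
rewrite pairingZl// pairingC pairingZl// pairingC PE -!EFinM lee_fin => h.
have Pg : 2 * P g <= (2 - e ^+ 2) * B.
  have -> : 2 * P g = 2 * (b * (b * P g)) * B.
    by rewrite -[P g in LHS]mul1r -bbB; ring.
  exact: ler_wpM2r.
have -> : (size s).*2%:R = 2 + (size (rem g s)).*2%:R :> R.
  have s0 : (0 < size s)%N by case: (s) gs.
  by rewrite size_rem// -(natrD _ 2); congr (_%:R); case: (size s) s0.
rewrite (big_rem g)//= addrAC [leRHS]mulrDl.
exact: lerD Pg (sumle _).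
Qed.

Lemma amenable_almost_invariant : hausdorff_space G -> locally_compact [set: G] ->
  amenable mu -> almost_invariant.
Proof.
move=> hG lcG /amenable_real_mean[L LP] s0 e0 e0pos.
apply: contrapT => noAI.
(* Adding 1 makes the family nonempty, and with [e <= 1] this gives [e ^ 2 <= 1 < 2 * size s], so
   that [La > 0]. *)
pose s := 1%g :: s0; pose e := Num.min e0 1.
have epos : 0 < e by rewrite lt_min e0pos ltr01.
have gap (u : L2 mu) : `|u| = 1 -> exists2 g, g \in s & e%:C%C <= `|left_regular g u - u|.
  move=> u1; apply: contrapT => nog; apply: noAI; exists u => // g gs.
  rewrite real_ltNge ?normr_real ?complex_real//; apply/negP => le_e0.
  apply: nog; exists g; first by rewrite inE gs orbT.
  by apply: le_trans le_e0; rewrite lecR ge_min lexx.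
have [K cK K0] := exists_compact_gt0 mu.
have [B [cB B1 symB KB sB]] := compact_generating_set s lcG cK.
have [xi [nxi xi1 fxi xi0]] := exists_weight mu hG cB.
pose La := (size s).*2%:R - e ^+ 2.
have e2 : 0 < e ^+ 2 by rewrite exprn_gt0.
have La0 : 0 < La.
  rewrite subr_gt0; apply: (@le_lt_trans _ _ 1); last by rewrite ltr1n.
  by rewrite expr_le1// ?(ltW epos)// ge_min lexx orbT.
(* The correlation is known to be positive on the subgroup generated by [B] only. Composing with
   [coset_part] makes it positive on [G], and commutes with the walk because [s] lies in that
   subgroup. *)
pose D (x : borel G) := correlation mu K xi (coset_part B x).
have gens g : g \in s -> generated B g by move=> /sB; exact: sub_generated.
have gensV g : g \in s -> generated B g^-1%g by move=> /gens; exact: generated_inv.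
have walkD n x : iter n (walk s) D x = iter n (walk s) (correlation mu K xi) (coset_part B x).
  elim: n x => // n IH x; rewrite !iterS /walk big_seq [RHS]big_seq.
  apply: eq_bigr => g gs; rewrite !IH !coset_partM//; [exact: gensV|exact: gens].
apply: (@mean_no_decay R G L LP s D (fine (pairing mu xi xi + mu K)) La).
- apply: usc_measurable_borel => a.
  have := open_coset_part B1 symB (open_correlation_lt hG cK nxi xi1 fxi a).
  by [].
- move=> x; apply: (correlation_gt0 hG cK nxi fxi K0 xi0 KB).
  exact: generated_coset_part.
- exact: ltW.
- by rewrite gtrBl.
- move=> n x; rewrite walkD; apply: (correlation_decay hG cK nxi fxi La0).
  exact: spectral_gap_of.
Qed.

End almost_invariant_vectors.

(** * Almost invariant vectors yield concentration *)

Section sphere.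
Variables (R : realType) (G : topologicalGroupType) (mu : left_haar R G).
Local Open Scope quotient_scope.

Lemma left_regularM (g h : G) (u : L2 mu) :
  left_regular g (left_regular h u) = left_regular (g * h)%g u.
Proof.
rewrite [left_regular h u]/left_regular left_regular_pi /left_regular.
congr (\pi_(L2 mu) _); apply/val_inj/funext => x /=.
by rewrite /left_translate invgM mulgA.
Qed.

Lemma left_regular1 (u : L2 mu) : left_regular 1%g u = u.
Proof.
rewrite /left_regular -[RHS]reprK; congr (\pi_(L2 mu) _); apply/val_inj/funext => x /=.
by rewrite /left_translate invg1 mul1g.
Qed.

Lemma sphere_entourage (V : set (L2sphere mu * L2sphere mu)) : entourage V ->
  exists2 e : R, 0 < e & forall u v : L2sphere mu, `|val u - val v| < e%:C%C -> V (u, v).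
Proof.
move=> [W]; rewrite -entourage_from_ballE => -[e /= e0 eW] WV.
have eE := gt0_ReE e0.
exists (complex.Re e); first by rewrite -(ltcR 0) -eE.
move=> u v uv; apply: (WV (u, v)); apply: eW => /=.
by rewrite -ball_normE /ball_ /= eE.
Qed.

(** If every member of the cover failed, each would exclude vectors almost invariant for some finite
    family and tolerance. The union of these families and the least tolerance would exclude them
    from the whole sphere. *)
Lemma almost_invariant_concentration : almost_invariant mu ->
  concentration_property (sphere_action mu).
Proof.
move=> AI gamma /finite_seqP[l gl] cover; apply: contrapT => noA.
pose moved (s : seq G) e (A : set (L2sphere mu)) := forall u, A u ->
  ~ (forall g, g \in s -> `|left_regular g (val u) - val u| < e%:C%C).
have each A : A \in l -> exists s, exists2 e : R, 0 < e & moved s e A.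
  move=> Al; have gA : gamma A by rewrite gl.
  apply: contrapT => nos; apply: noA; exists A => // V eV n g n0.
  have [e e0 eV'] := sphere_entourage eV.
  (* If each inverse of [g i] moves [u] in [A] by less than [e], then [g_i^-1 u] lies in [V[A]] and
     [u = g_i (g_i^-1 u)] is a common point of the translates. *)
  apply: contrapT => empty; apply: nos; exists [seq (g i)^-1%g | i <- enum 'I_n], e => //.
  move=> u Au close; apply: empty; exists u => i _.
  exists (sphere_action mu (g i)^-1%g u); last first.
    by apply/val_inj; rewrite /= left_regularM mulgV left_regular1.
  exists u => //; apply: eV'; rewrite distrC; apply: close.
  by apply/mapP; exists i => //; rewrite mem_enum.
have [s [e e0 all_moved]] : exists s, exists2 e : R, 0 < e & forall A, A \in l -> moved s e A.
  move: each; clear; elim: l => [|A l IH] each; first by exists [::], 1.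
  have [|s1 [e1 e10 m1]] := IH; first by move=> B Bl; apply: each; rewrite inE Bl orbT.
  have [s2 [e2 e20 m2]] := each A (mem_head _ _).
  exists (s1 ++ s2), (Num.min e1 e2); first by rewrite lt_min e10.
  move=> B; rewrite inE => /predU1P[->|Bl] u Bu close.
    apply: (m2 u Bu) => g gs; apply: lt_le_trans (close g _) _.
      by rewrite mem_cat gs orbT.
    by rewrite lecR ge_min lexx orbT.
  apply: (m1 B Bl u Bu) => g gs; apply: lt_le_trans (close g _) _.
    by rewrite mem_cat gs.
  by rewrite lecR ge_min lexx.
have [u u1 close] := AI s e e0.
have us : u \in L2sphere mu by apply/mem_set.
have : [set: L2sphere mu] (SigSub us) by [].
rewrite -cover gl => -[A /= Al Au].
exact: (all_moved A Al _ Au).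
Qed.

End sphere.

(** * Limits of bounded functions along an ultrafilter *)

Section ultralimit.
Variables (R : realType) (X : Type) (U : set_system X) (UU : UltraFilter U).

Definition bounded_real : set (X -> R) :=
  [set f : X -> R | exists M : R, forall x, `|f x| <= M].

Lemma bounded_cvg_ultra f : bounded_real f -> cvg (f @ U).
Proof.
move=> [M fM]; have := @segment_compact R (- M) M; rewrite compact_ultra.
have UfU : UltraFilter (f @ U).
  split=> [|H HH le_UH].
    exact: fmap_proper_filter.
  apply/seteqP; split=> // B HB; have [//|UB] := in_ultra_setVsetC (f @^-1` B) UU.
  case: (@filter_not_empty _ H _); rewrite -(setICr B).
  by apply: filterI => //; exact: (le_UH _ UB).
move=> /(_ (f @ U) UfU) [|p [_ fp]]; last exact: cvgP fp.
by apply: (@filterE _ U) => x /=; rewrite in_itv /= -ler_norml.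
Qed.

Definition ultralimit (f : X -> R) : R := lim (f @ U).

Lemma ultralimit_cvg f : bounded_real f -> f @ U --> ultralimit f.
Proof. exact: bounded_cvg_ultra. Qed.

Lemma bounded_realD (a : R) f g : bounded_real f -> bounded_real g ->
  bounded_real (fun x => a * f x + g x).
Proof.
move=> [M fM] [N gN]; exists (`|a| * M + N) => x.
by rewrite (le_trans (ler_normD _ _))// lerD// normrM ler_wpM2l.
Qed.

Lemma ultralimitD (a : R) f g : bounded_real f -> bounded_real g ->
  ultralimit (fun x => a * f x + g x) = a * ultralimit f + ultralimit g.
Proof.
move=> bf bg; apply: cvg_lim => //; apply: cvgD; last exact: ultralimit_cvg.
by apply: cvgMr; exact: ultralimit_cvg.
Qed.

Lemma ultralimit_ge0 f : bounded_real f -> (forall x, 0 <= f x) -> 0 <= ultralimit f.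
Proof.
move=> bf f0; apply: limr_ge; first exact: bounded_cvg_ultra.
exact: filterE.
Qed.

Lemma ultralimit_near f (e : R) : bounded_real f -> 0 < e ->
  U [set x | `|ultralimit f - f x| < e].
Proof. by move=> /ultralimit_cvg /cvgrPdist_lt h e0; exact: h. Qed.

Lemma ultralimit_cst c : ultralimit (fun=> c) = c.
Proof. exact: lim_cst. Qed.

End ultralimit.

(** * Concentration yields an invariant mean *)

Section concentration_mean.
Variables (R : realType) (X : uniformType) (G : Type) (act : G -> X -> X) (one : G).
Hypothesis act_one : forall x, act one x = x.
Hypothesis act_unif : forall g, unif_continuous (act g).
Local Notation C := (R[i]^o).

Definition concentrated (A : set X) := forall V : set (X * X), entourage V ->
  forall (n : nat) (g : 'I_n -> G), (0 < n)%N ->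
    \bigcap_(i in [set: 'I_n]) (act (g i) @` ent_neighbourhood V A) !=set0.

(** The sets whose complement is covered by finitely many sets that are not concentrated form a
    filter, and the concentration property says that it is proper. Any ultrafilter above it contains
    the complement of each set that is not concentrated. *)
Lemma concentrated_ultrafilter : concentration_property act ->
  exists2 U : set_system X, UltraFilter U & forall A, U A -> concentrated A.
Proof.
move=> conc.
pose F (A : set X) := exists gamma : set (set X), [/\ finite_set gamma,
  forall B, gamma B -> ~ concentrated B & ~` A `<=` \bigcup_(B in gamma) B].
have FF : ProperFilter F.
  split.
    move=> [gamma [fin bad cover]].
    have [|A gA cA] := conc gamma fin; last exact: bad cA.
    by apply/seteqP; split => // x _; apply: cover => -[].
  split.
  - by exists set0; split => //; rewrite setCT.
  - move=> A B [g1 [f1 b1 c1]] [g2 [f2 b2 c2]]; exists (g1 `|` g2); split.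
    + by rewrite finite_setU.
    + by move=> D [/b1|/b2].
    + by rewrite setCI bigcup_setU; exact: setUSS.
  - move=> A B AB [g [f b c]]; exists g; split => //.
    by apply: subset_trans c; exact: subsetC.
have [U [UU FU]] := ultraFilterLemma FF.
exists U => // A UA; apply: contrapT => nA.
have : U (~` A).
  apply: FU; exists [set A]; split => //; first by move=> B ->.
  by rewrite bigcup_set1 setCK.
move=> UCA; apply: (@filter_not_empty _ U _); rewrite -(setICr A).
exact: filterI.
Qed.

(** The set [A] where [f] is near [L2] and [f (g x)] near [L1] belongs to [U], hence is
    concentrated. A common point [z] of [V'[A]] and [g V'[A]] makes [f z] close to both limits. *)
Lemma ultralimit_invariant (U : set_system X) (f : X -> R) g :
  UltraFilter U -> (forall A, U A -> concentrated A) ->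
  bounded_real f ->
  (forall e, 0 < e -> exists2 V, entourage V & forall x y, V (x, y) -> `|f x - f y| < e) ->
  ultralimit U (fun x => f (act g x)) = ultralimit U f.
Proof.
move=> UU conc bf uf.
have bfg : bounded_real (fun x => f (act g x)) by case: bf => M fM; exists M => x.
set L1 := ultralimit U _; set L2 := ultralimit U f.
(* Four errors below [e] will separate [L1] from [L2]: two from the definition of [A] and two from
   uniform continuity. *)
apply: contrapT => L12; pose e := `|L1 - L2| / 4.
have e0 : 0 < e by rewrite divr_gt0// normr_gt0 subr_eq0; exact/eqP.
have [V eV fV] := uf e e0.
(* The second entourage keeps points close after [g] is applied. *)
pose V' := V `&` [set xy | V (act g xy.1, act g xy.2)].
have eV' : entourage V' by apply: filterI => //; exact: (@act_unif g V eV).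
pose A := [set x | `|L2 - f x| < e] `&` [set x | `|L1 - f (act g x)| < e].
have UA : U A by apply: filterI; apply: ultralimit_near.
have [z zI] := conc A UA V' eV' 2%N (fun i => if i == ord0 then one else g) isT.
have [y [x [xA _] [xy _]] /= zE] := zI ord0 I.
have [y' [x' [_ x'A] [_ /= xy']] /= zE'] := zI (lift ord0 ord0) I.
rewrite /= in zE'; rewrite act_one in zE; rewrite -zE in zE'.
have h1 := fV _ _ xy; have h2 := fV _ _ xy'; rewrite zE' in h2.
have : `|L1 - L2| < 4 * e.
  rewrite (_ : L1 - L2 = (L1 - f (act g x')) + (f (act g x') - f y) - (L2 - f x) - (f x - f y)).
    apply: (le_lt_trans (ler_normB _ _)).
    apply: (le_lt_trans (lerD (ler_normB _ _) (lexx _))).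
    apply: (le_lt_trans (lerD (lerD (ler_normD _ _) (lexx _)) (lexx _))).
    by move: xA x'A h1 h2 => /= xA x'A h1 h2; lra.
  by ring.
by rewrite /e mulrC divfK ?ltxx// pnatr_eq0.
Qed.

Lemma concentration_mean : concentration_property act -> has_invariant_mean R act.
Proof.
move=> /concentrated_ultrafilter[U UU conc].
have cont (p : C -> R) (f : X -> C) : (forall z w, p z - p w = p (z - w)) ->
    (forall z, `|p z| <= Normc.normc z) -> unif_continuous f ->
    forall e, 0 < e -> exists2 V, entourage V & forall x y, V (x, y) -> `|p (f x) - p (f y)| < e.
  move=> pB pn uf e e0.
  have eb : entourage [set xy : C * C | ball xy.1 (e%:C%C : C) xy.2].
    by rewrite -entourage_from_ballE; exists e%:C%C => //=; rewrite ltcR.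
  exists [set xy | ball (f xy.1) (e%:C%C : C) (f xy.2)]; first exact: (uf _ eb).
  move=> x y /=; rewrite -ball_normE /ball_ /= => h.
  rewrite pB; apply: (le_lt_trans (pn _)); rewrite -ltcR.
  by move: h; case: (f x - f y).
have reB (z w : C) : complex.Re z - complex.Re w = complex.Re (z - w).
  by case: z; case: w.
have imB (z w : C) : complex.Im z - complex.Im w = complex.Im (z - w).
  by case: z; case: w.
have bRe f : Cbu f -> bounded_real (fun x : X => complex.Re (f x : C)).
  by move=> [[M fM] _]; exists M => x; exact: le_trans (Re_le_normc _) (fM x).
have bIm f : Cbu f -> bounded_real (fun x : X => complex.Im (f x : C)).
  by move=> [[M fM] _]; exists M => x; exact: le_trans (Im_le_normc _) (fM x).
exists (complex_mean (ultralimit U)); split.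
  apply: (@mean_of_real _ _ _ _ _ (@bounded_real R X)).
  - by move=> f Ef; split; [exact: bRe|exact: bIm].
  - split; first by exists 1 => x; rewrite Normc.normc1.
    move=> V eV; apply: (@filterE _ (@entourage X)) => -[x y] /=; exact: entourage_refl.
  - exact: bounded_realD.
  - by move=> a f g; exact: ultralimitD.
  - by move=> f bf f0; apply: (@ultralimit_ge0 _ _ U UU f bf) => x; exact: f0.
  - exact: ultralimit_cst.
move=> g f Cf; rewrite /complex_mean; congr (_ +i* _)%C.
  apply: (@ultralimit_invariant U (fun x => complex.Re (f x)) g) => //; first exact: bRe.
  by apply: cont => //; [exact: Re_le_normc|exact: Cf.2].
apply: (@ultralimit_invariant U (fun x => complex.Im (f x)) g) => //; first exact: bIm.
by apply: cont => //; [exact: Im_le_normc|exact: Cf.2].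
Qed.

End concentration_mean.

(** * Locally null sets and integrable weights *)

Section locally_null.
Variables (R : realType) (G : topologicalGroupType) (mu : left_haar R G).
Hypothesis hausdorffG : hausdorff_space G.

Global Instance locally_ae_filter : Filter (locally_ae mu).
Proof.
split.
- by move=> K _; rewrite setDT; exact: negligible_set0.
- by move=> A B hA hB K cK; rewrite setDIr; apply: negligibleU; [exact: hA|exact: hB].
- by move=> A B AB hA K cK; apply: negligibleS (hA K cK); exact: setDS.
Qed.

(** Outer regularity encloses [A] in an open [U] of finite measure, and inner regularity fills [U]
    by a compact [K] up to [e]. Then [A] is covered by the null set [K & A] and by [U \ K]. *)
Lemma locally_null_finite (A : set (borel G)) : measurable A -> (mu A < +oo)%E ->
  (forall K : set G, compact K -> mu.-negligible (K `&` A)) -> mu A = 0%E.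
Proof.
move=> mA fA nA; have finA : mu A \is a fin_num by rewrite ge0_fin_numE.
have : (mu A < mu A + 1%E)%E by rewrite lteDl// lte_fin.
rewrite {1}(haar_outer (haarP mu) mA) => /ereal_inf_lt[_ [U [oU AU] <-] Ufin].
have mU := open_measurable_borel oU.
have finU : mu U \is a fin_num.
  by rewrite ge0_fin_numE// (lt_le_trans Ufin)// leey.
apply/eqP; rewrite eq_le measure_ge0 andbT; apply/lee_addgt0Pr => e e0; rewrite add0e.
have : (mu U - e%:E < mu U)%E by rewrite lteBlDr// lteDl// lte_fin.
rewrite [X in (_ < X)%E -> _](haar_inner (haarP mu) oU).
move=> /ereal_sup_gt[_ [K [cK KU] <-] UK].
have mK := compact_measurable_borel hausdorffG cK.
have finK : mu K \is a fin_num.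
  by rewrite ge0_fin_numE//; exact: (haar_compact (haarP mu)).
apply: (@le_trans _ _ (mu ((K `&` A) `|` (U `\` K)))).
  apply: le_measure; rewrite ?inE//.
    by apply: measurableU; [exact: measurableI|exact: measurableD].
  by move=> x Ax; have [Kx|nKx] := pselect (K x); [left|right; split => //; exact: AU].
apply: le_trans (measureU2 _ _ _) _; [exact: measurableI|exact: measurableD|].
rewrite (measure_negligible _ (nA K cK)) ?add0e; last exact: measurableI.
have e1 : (mu U = mu K + mu (U `\` K))%E.
  by rewrite -measureU ?setDUK// ?setDIK//; exact: measurableD.
move: UK; rewrite e1 lteBlDr// lteD2lE// => /ltW.
by [].
Qed.

(** The support of an integrable [rho] is the union of the sets where [rho >= 1 / (n + 1)], of
    finite measure by Markov's inequality; on these, locally null means null. *)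
Lemma locally_ae_weight (P : set (borel G)) (rho : borel G -> R) : measurable P ->
  locally_ae mu P -> measurable_fun [set: borel G] rho -> (forall x, 0 <= rho x) ->
  (\int[mu]_x (rho x)%:E < +oo)%E -> {ae mu, forall x, P x \/ rho x = 0}.
Proof.
move=> mP laP mr r0 fr.
pose B n := ~` P `&` [set x | n.+1%:R^-1 <= rho x].
have mB n : measurable (B n).
  apply: measurableI; first exact: measurableC.
  rewrite -[X in measurable X]setTI.
  rewrite (_ : [set x | _] = rho @^-1` `[n.+1%:R^-1, +oo[%classic); first exact: mr.
  by apply/seteqP; split => x /=; rewrite in_itv /= andbT.
have muB n : mu (B n) = 0%E.
  apply: locally_null_finite => //.
    have n0 : (0 < n.+1%:R^-1 :> R) by rewrite invr_gt0.
    have mi : measurable_fun [set: borel G] (fun x => (\1_(B n) x)%:E : \bar R).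
      by apply/measurable_EFinP; exact: measurable_indic.
    have : ((n.+1%:R^-1)%:E * mu (B n) < +oo)%E.
      apply: le_lt_trans fr; rewrite -[B n in leLHS]setIT -integral_indic//.
      rewrite -(ge0_integralZl mu measurableT mi)//.
      apply: (ge0_le_integral mu measurableT).
      - by move=> x _; rewrite -EFinM lee_fin mulr_ge0// ltW.
      - under eq_fun do rewrite -EFinM.
        by apply/measurable_EFinP; apply: measurable_funM => //; exact: measurable_indic.
      - exact/measurable_EFinP.
      - move=> x _; rewrite -EFinM lee_fin indicE.
        by have [/set_mem[_ /=]|_] := boolP (x \in B n); rewrite ?mulr1 ?mulr0.
    have := measure_ge0 mu (B n); case: (mu (B n)) => [q _ _|_|//]; first exact: ltry.
    by rewrite gt0_muley ?lte_fin.
  move=> K cK; apply: negligibleS (laP K cK) => x [Kx [nPx _]]; by split.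
have : mu.-negligible (\bigcup_n B n).
  apply: negligible_bigcup => n; apply/negligibleP; first exact: mB.
  exact: muB.
apply: negligibleS => x /= /not_orP[nPx /eqP rx].
have {}rx : 0 < rho x by rewrite lt0r rx r0.
have [n nr] : exists n : nat, n.+1%:R^-1 < rho x.
  by exists (Num.truncn (rho x)^-1); rewrite invf_plt ?posrE//; exact: truncnS_gt.
by exists n => //; split => //=; exact: ltW.
Qed.

End locally_null.

(** * The uniformity of the sphere in terms of real radii *)

Section sphere_uniformity.
Variables (R : realType) (G : topologicalGroupType) (mu : left_haar R G).
Local Open Scope quotient_scope.

Lemma entourage_sphere_ball (e : R) : 0 < e ->
  entourage [set uv : L2sphere mu * L2sphere mu | `|val uv.1 - val uv.2| < e%:C%C].
Proof.
move=> e0; exists [set xy : L2 mu * L2 mu | ball xy.1 e%:C%C xy.2].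
  by rewrite -entourage_from_ballE; exists e%:C%C => //=; rewrite ltcR.
by move=> [u v] /=; rewrite -ball_normE.
Qed.

Lemma left_regularB (g : G) (u v : L2 mu) :
  left_regular g (u - v) = left_regular g u - left_regular g v.
Proof.
rewrite -[u in LHS]reprK -[v in LHS]reprK pi_L2B left_regular_pi.
rewrite /left_regular pi_L2B; congr (\pi_(L2 mu) _).
exact/val_inj.
Qed.

Lemma sphere_action_unif (g : G) : unif_continuous (sphere_action mu g).
Proof.
move=> V /sphere_entourage[e e0 eV]; apply: filterS (entourage_sphere_ball e0).
move=> [u v] /= uv; apply: eV => /=.
by rewrite -left_regularB norm_left_regular.
Qed.

Lemma unif_continuous_sphere (F : L2sphere mu -> R) :
  (forall e : R, 0 < e -> exists2 d : R, 0 < d &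
    forall u v : L2sphere mu, `|val u - val v| < d%:C%C -> `|F u - F v| < e) ->
  unif_continuous (fun u => (F u)%:C%C : R[i]^o).
Proof.
move=> uF V; rewrite -entourage_from_ballE => -[e /= e0 eV].
have eE := gt0_ReE e0.
have re0 : 0 < complex.Re e by rewrite -(ltcR 0) -eE.
have [d d0 dF] := uF _ re0.
apply: filterS (entourage_sphere_ball d0) => -[u v] /= /dF uv; apply: eV => /=.
rewrite -ball_normE /ball_ /= eE -rmorphB /= normc_def /= expr0n addr0 sqrtr_sqr.
by rewrite ltcR.
Qed.

End sphere_uniformity.

(** From [a ^ 2 - b ^ 2 = (a - b) (a + b)] and the arithmetic-geometric inequality with weight [d].
    The bound is linear in the squares, so it can be integrated directly. *)
Lemma mul_sqB_le (R : realType) (M d q a b h : R) : 0 <= M -> 0 < d -> 0 <= a -> 0 <= b ->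
  `|h| <= M -> `|a - b| <= q ->
  h * a ^+ 2 <= M / (2 * d) * q ^+ 2 + M * d * (a ^+ 2 + b ^+ 2) + h * b ^+ 2.
Proof.
move=> M0 d0 a0 b0 hM abq.
have s1 : h * (a ^+ 2 - b ^+ 2) <= M * (q * (a + b)).
  apply: le_trans (ler_norm _) _; rewrite normrM subr_sqr normrM.
  rewrite (ger0_norm (addr_ge0 a0 b0)); apply: ler_pM => //.
    by rewrite mulr_ge0// addr_ge0.
  by rewrite ler_wpM2r// addr_ge0.
have s2 : q * (a + b) <= q ^+ 2 / (2 * d) + d * (a ^+ 2 + b ^+ 2).
  rewrite -subr_ge0.
  have -> : q ^+ 2 / (2 * d) + d * (a ^+ 2 + b ^+ 2) - q * (a + b) =
      (q - d * (a + b)) ^+ 2 / (2 * d) + d / 2 * (a - b) ^+ 2.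
    by field; rewrite gt_eqF.
  have d2 : 0 <= (2 * d)^-1 by rewrite invr_ge0 mulr_ge0// ltW.
  have dh : 0 <= d / 2 by rewrite divr_ge0// ltW.
  by apply: addr_ge0; apply: mulr_ge0 => //; exact: sqr_ge0.
have -> : M / (2 * d) * q ^+ 2 + M * d * (a ^+ 2 + b ^+ 2) =
    M * (q ^+ 2 / (2 * d) + d * (a ^+ 2 + b ^+ 2)).
  by field; rewrite gt_eqF.
rewrite -lerBlDr -mulrBr; apply: le_trans s1 _; exact: ler_wpM2l.
Qed.

(** * An invariant mean on the sphere yields amenability *)

Section mean_transfer.
Variables (R : realType) (G : topologicalGroupType) (mu : left_haar R G).
Hypothesis hausdorffG : hausdorff_space G.
Local Open Scope quotient_scope.

(** For a unit vector, a probability density; it is read off a chosen representative, hence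
    meaningful up to a null set. *)
Definition weight (u : L2 mu) (x : borel G) : R := cabs (repr u : L2fun mu) x ^+ 2.

Let mL2 (f : L2fun mu) : measurable_fun [set: borel G] (fun x => cabs f x ^+ 2).
Proof.
apply: measurable_funX; apply: measurable_normc.
by case: f => f /= /asboolP[].
Qed.

Let int_L2 (f : L2fun mu) : mu.-integrable [set: borel G] (fun x => (cabs f x ^+ 2)%:E).
Proof.
apply/integrableP; split; first exact/measurable_EFinP.
under eq_integral do rewrite gee0_abs ?lee_fin ?sqr_ge0//.
by rewrite -L2seminorm_sq ltry.
Qed.

Let weight_ge0 u x : 0 <= weight u x. Proof. exact: sqr_ge0. Qed.

Let norm_pi (f : L2fun mu) : `|\pi_(L2 mu) f| = (L2seminorm mu f)%:C%C.
Proof. by rewrite [LHS]/(L2norm _) /L2norm L2seminorm_pi. Qed.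

Let int_weight (u : L2sphere mu) : \int[mu]_x weight (val u) x = 1.
Proof.
rewrite /Rintegral -L2seminorm_sq /=.
have : `|val u| = 1 by case: u => u /= /set_mem.
by rewrite -[val u in X in X -> _]reprK norm_pi => -[->]; rewrite expr1n.
Qed.

Definition locally_bounded : set (borel G -> R) :=
  [set h : borel G -> R | measurable_fun [set: borel G] h /\
    exists M : R, locally_ae mu [set x : borel G | `|h x| <= M]].

Lemma locally_aeS (A B : set (borel G)) : A `<=` B -> locally_ae mu A -> locally_ae mu B.
Proof. exact: filterS. Qed.

Lemma locally_bounded_lin (a : R) h k : locally_bounded h -> locally_bounded k ->
  locally_bounded (fun x => a * h x + k x).
Proof.
move=> [mh [M hM]] [mk [N kN]]; split.
  by apply: measurable_funD => //; exact: measurable_funM.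
exists (`|a| * M + N); apply: filterS2 hM kN => x /= hM kN.
by rewrite (le_trans (ler_normD _ _))// lerD// normrM ler_wpM2l.
Qed.

Lemma locally_bounded_cst c : locally_bounded (fun=> c).
Proof. by split; [exact: measurable_cst|exists `|c|; apply: filterE => x /=]. Qed.

Let mle (h : borel G -> R) (M : R) : measurable_fun [set: borel G] h ->
  measurable [set x | `|h x| <= M].
Proof.
move=> mh; rewrite -[X in measurable X]setTI.
rewrite (_ : [set x | _] = (fun x => `|h x|) @^-1` `]-oo, M]%classic).
  exact: (measurableT_comp _ mh).
by apply/seteqP; split => x /=; rewrite in_itv.
Qed.

Let int_fin (u : L2 mu) : (\int[mu]_x (weight u x)%:E < +oo)%E.
Proof. by rewrite -L2seminorm_sq ltry. Qed.

Let ae_weight (u : L2 mu) (P : set (borel G)) : measurable P -> locally_ae mu P ->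
  {ae mu, forall x, P x \/ weight u x = 0}.
Proof. by move=> mP lP; apply: locally_ae_weight => //; exact: mL2. Qed.

Lemma integrable_weight h u : locally_bounded h ->
  mu.-integrable [set: borel G] (fun x => (h x * weight u x)%:E).
Proof.
move=> [mh [M hM]]; apply/integrableP; split.
  by apply/measurable_EFinP; apply: measurable_funM => //; exact: mL2.
apply: (@le_lt_trans _ _ (\int[mu]_x (`|M|%:E * (weight u x)%:E))%E).
  apply: ae_ge0_le_integral => //.
  - apply: measurableT_comp => //; apply/measurable_EFinP.
    by apply: measurable_funM => //; exact: mL2.
  - by move=> x _; rewrite -EFinM lee_fin mulr_ge0.
  - under eq_fun do rewrite -EFinM.
    by apply/measurable_EFinP; apply: measurable_funM => //; exact: mL2.
  apply: filterS (ae_weight u (mle M mh) hM) => x + _.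
  rewrite -EFinM lee_fin normrM (ger0_norm (weight_ge0 u x)) => -[/= hx|->].
    by rewrite ler_wpM2r// (le_trans hx)// ler_norm.
  by rewrite !mulr0.
have mw : measurable_fun [set: borel G] (fun x => (weight u x)%:E) by apply/measurable_EFinP; exact: mL2.
have w0 x : [set: borel G] x -> (0 <= (weight u x)%:E)%E by rewrite lee_fin.
have M0 : (0 <= `|M|%:E)%E by rewrite lee_fin.
rewrite (ge0_integralZl mu measurableT mw w0 M0).
by apply: lte_mul_pinfty => //; exact: int_fin.
Qed.

Lemma Rintegral_ae_ge0 (f : borel G -> R) : measurable_fun [set: borel G] f ->
  {ae mu, forall x, 0 <= f x} -> 0 <= \int[mu]_x f x.
Proof.
move=> mf f0; rewrite /Rintegral (ae_eq_integral (fun x => `|f x|%:E))//.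
- by apply: fine_ge0; apply: integral_ge0 => x _; rewrite lee_fin.
- exact/measurable_EFinP.
- by apply/measurable_EFinP; exact: measurableT_comp.
- by apply: filterS f0 => x fx _; rewrite ger0_norm.
Qed.

Definition average (h : borel G -> R) (u : L2 mu) : R := \int[mu]_x (h x * weight u x).

Lemma average_lin a h k u : locally_bounded h -> locally_bounded k ->
  average (fun x => a * h x + k x) u = a * average h u + average k u.
Proof.
move=> lh lk; rewrite /average -RintegralZl//; last exact: integrable_weight.
rewrite -RintegralD//; last 2 first.
- have := integrable_weight u (locally_bounded_lin a lh (locally_bounded_cst 0)).
  by under eq_fun do rewrite addr0 -mulrA.
- exact: integrable_weight.
by apply: eq_Rintegral => x _; rewrite mulrDl mulrA.
Qed.

Lemma average_ge0 h u : locally_bounded h -> locally_ae mu [set x : borel G | 0 <= h x] ->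
  0 <= average h u.
Proof.
move=> lh h0; have [mh _] := lh; apply: Rintegral_ae_ge0.
  by apply: measurable_funM => //; exact: mL2.
have mP : measurable [set x | 0 <= h x].
  rewrite -[X in measurable X]setTI.
  rewrite (_ : [set x | _] = h @^-1` `[0, +oo[%classic); first exact: mh.
  by apply/seteqP; split => x /=; rewrite in_itv /= andbT.
apply: filterS (ae_weight u mP h0) => x [/= hx|->]; last by rewrite mulr0.
exact: mulr_ge0.
Qed.

Lemma average_cst c (u : L2sphere mu) : average (fun=> c) (val u) = c.
Proof.
rewrite /average RintegralZl//; last exact: int_L2.
by rewrite int_weight mulr1.
Qed.

(** Integrating [mul_sqB_le] with [|u| = |v| = 1] and [|u - v| < d] gives at most [M d / 2 + 2 M d],
    rounded up to [3 M d]. *)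
Lemma average_le h (u v : L2sphere mu) (M d : R) : 0 <= M -> 0 < d ->
  locally_bounded h -> locally_ae mu [set x : borel G | `|h x| <= M] ->
  `|val u - val v| < d%:C%C ->
  average h (val u) - average h (val v) <= 3 * M * d.
Proof.
move=> M0 d0 lh hM uv; have [mh _] := lh.
pose f : L2fun mu := repr (val u) - repr (val v).
pose k x := cabs f x ^+ 2.
have fd : L2seminorm mu f < d.
  by move: uv; rewrite -[val u]reprK -[val v]reprK pi_L2B norm_pi ltcR.
have kd : \int[mu]_x k x <= d ^+ 2.
  rewrite /Rintegral -L2seminorm_sq /=.
  by rewrite lerXn2r ?nnegrE ?L2seminorm_ge0 ?(ltW d0)// ltW.
have ik := int_L2 f.
have iu := integrable_weight (val u) lh; have iv := integrable_weight (val v) lh.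
pose c := M / (2 * d).
have c0 : 0 <= c by rewrite divr_ge0// mulr_ge0// ltW.
pose w x := weight (val u) x + weight (val v) x.
have iw : mu.-integrable [set: borel G] (EFin \o w).
  exact: (integrableD measurableT (int_L2 (repr (val u))) (int_L2 (repr (val v)))).
have W2 : \int[mu]_x w x = 2.
  by rewrite RintegralD ?int_weight//; exact: int_L2.
pose B x := c * k x + M * d * w x.
have i1 : mu.-integrable [set: borel G] (EFin \o (fun x => c * k x)).
  exact: (integrableZl measurableT c ik).
have i2 : mu.-integrable [set: borel G] (EFin \o (fun x => M * d * w x)).
  exact: (integrableZl measurableT (M * d) iw).
have iB : mu.-integrable [set: borel G] (EFin \o B).
  exact: (integrableD measurableT i1 i2).
have Bd : \int[mu]_x B x <= 3 * M * d.
  rewrite (RintegralD measurableT i1 i2) !RintegralZl// W2.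
  apply: (@le_trans _ _ (c * d ^+ 2 + M * d * 2)); first by rewrite lerD2r ler_wpM2l.
  have -> : c * d ^+ 2 = M * d / 2 by rewrite /c; field; rewrite gt_eqF.
  rewrite -subr_ge0 (_ : _ - _ = M * d / 2); last by field.
  by rewrite divr_ge0// mulr_ge0// ltW.
apply: le_trans Bd; rewrite lerBlDr -subr_ge0.
have iBv : mu.-integrable [set: borel G] (EFin \o (fun x => B x + h x * weight (val v) x)).
  exact: (integrableD measurableT iB iv).
rewrite /average -RintegralD// -RintegralB//.
apply: Rintegral_ae_ge0.
  have mB : measurable_fun [set: borel G] B.
    apply: measurable_funD; apply: measurable_funM => //; first exact: mL2.
    by apply: measurable_funD; exact: mL2.
  apply: measurable_funB; last by apply: measurable_funM => //; exact: mL2.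
  by apply: measurable_funD => //; apply: measurable_funM => //; exact: mL2.
have au := ae_weight (val u) (mle M mh) hM; have av := ae_weight (val v) (mle M mh) hM.
apply: filterS2 au av => x xu xv.
have k0 : 0 <= k x by exact: sqr_ge0.
have w0 : 0 <= w x by rewrite addr_ge0.
have Md : 0 <= M * d by rewrite mulr_ge0// ltW.
have B0 : 0 <= B x by apply: addr_ge0; exact: mulr_ge0.
(* The bound on [h] holds only locally almost everywhere; where it fails, both weights vanish for
   almost every [x] and [0 <= B x] suffices. *)
have [hx|[u0 v0]] : `|h x| <= M \/ (weight (val u) x = 0 /\ weight (val v) x = 0).
- by case: xu => [hx|u0]; [left|case: xv => [hx|v0]; [left|right]].
- have normB (z z' : R[i]) : Normc.normc z - Normc.normc z' <= Normc.normc (z - z').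
    by rewrite lerBlDr -{1}[z](subrK z'); exact: le_normcD.
  have normBC (z z' : R[i]) : Normc.normc (z - z') = Normc.normc (z' - z).
    by case: z z' => p q [r t] /=; congr Num.sqrt; ring.
  have ab := normB ((repr (val u) : L2fun mu) x) ((repr (val v) : L2fun mu) x).
  have ba := normB ((repr (val v) : L2fun mu) x) ((repr (val u) : L2fun mu) x).
  rewrite normBC in ba.
  have a0 := cabs_ge0 (repr (val u) : L2fun mu) x.
  have b0 := cabs_ge0 (repr (val v) : L2fun mu) x.
  have f0 := cabs_ge0 f x.
  rewrite -[X in X <= _]/(cabs (repr (val u) : L2fun mu) x - cabs (repr (val v) : L2fun mu) x) in ab.
  rewrite -[X in X <= _]/(cabs (repr (val v) : L2fun mu) x - cabs (repr (val u) : L2fun mu) x) in ba.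
  rewrite subr_ge0; apply: mul_sqB_le => //.
  by rewrite ler_norml lerNl opprB; apply/andP.
- by rewrite u0 v0 !mulr0 addr0 subr0.
Qed.

Lemma integral_mulg (g : G) (f : borel G -> \bar R) : measurable_fun [set: borel G] f ->
  (\int[mu]_x f (g * x)%g = \int[mu]_x f x)%E.
Proof.
move=> mf; rewrite [RHS]integralE.
rewrite -(ge0_integral_mulg mu g (measurable_funepos mf) (funepos_ge0 f)).
rewrite -(ge0_integral_mulg mu g (measurable_funeneg mf) (funeneg_ge0 f)).
by rewrite [LHS]integralE funepos.unlock funeneg.unlock.
Qed.

(** The representative of [left_regular g u] agrees almost everywhere with the translate of that of
    [u]; the rest is the substitution of [g x] for [x]. *)
Lemma average_left_regular h (g : G) (u : L2 mu) : locally_bounded h ->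
  average h (left_regular g u) = average (fun x => h (g * x)%g) u.
Proof.
move=> [mh _]; rewrite /average /Rintegral; congr fine.
pose r x := weight u (g^-1 * x)%g.
have mr : measurable_fun [set: borel G] r.
  by apply: (measurableT_comp _ (measurable_mulg g^-1%g)); exact: mL2.
have mhr : measurable_fun [set: borel G] (fun x => (h x * r x)%:E).
  by apply/measurable_EFinP; exact: measurable_funM.
rewrite (ae_eq_integral (fun x => (h x * r x)%:E))//; last 2 first.
- by apply/measurable_EFinP; apply: measurable_funM => //; exact: mL2.
- pose f := L2translate g (repr u).
  have /asboolP : repr (left_regular g u) - f \in @L2null _ _ _ mu.
    by rewrite Quotient.idealrBE reprK.
  apply: filterS => x fx _; congr (_ * _)%:E.
  have {}fx : (repr (left_regular g u) : L2fun mu) x = f x.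
    by apply/eqP; rewrite -subr_eq0; apply/eqP.
  by rewrite /weight /cabs fx.
rewrite -(integral_mulg g mhr); apply: eq_integral => x _.
by rewrite /r mulKg.
Qed.

Lemma Cbu_average h : locally_bounded h ->
  Cbu (fun u : L2sphere mu => (average h (val u))%:C%C : R[i]^o).
Proof.
move=> lh; have [mh [M0 hM0]] := lh.
pose M := `|M0| + 1.
have Mpos : 0 < M by rewrite ltr_wpDl.
have hM : locally_ae mu [set x : borel G | `|h x| <= M].
  apply: locally_aeS hM0 => x /= hx; apply: (le_trans hx).
  by rewrite (le_trans (ler_norm _))// lerDl.
split.
  exists M => u; rewrite /= expr0n addr0 sqrtr_sqr ler_norml; apply/andP; split.
    have := @average_ge0 (fun x => 1 * h x + M) (val u) (locally_bounded_lin 1 lh (locally_bounded_cst M)).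
    rewrite average_lin//; last exact: locally_bounded_cst.
    rewrite average_cst mul1r -lerBlDr sub0r; apply; apply: locally_aeS hM => x /=.
    by rewrite ler_norml mul1r => /andP[]; lra.
  have := @average_ge0 (fun x => -1 * h x + M) (val u) (locally_bounded_lin (-1) lh (locally_bounded_cst M)).
  rewrite average_lin//; last exact: locally_bounded_cst.
  rewrite average_cst mulN1r addrC subr_ge0; apply; apply: locally_aeS hM => x /=.
  by rewrite ler_norml mulN1r => /andP[]; lra.
(* At this radius the Lipschitz bound [3 M d] equals [3 e / 4 < e]; adding 1 to the bound of [h]
   made [M] nonzero. *)
apply: unif_continuous_sphere => e e0; exists (e / (4 * M)).
  by rewrite divr_gt0// mulr_gt0.
move=> u v uv; have d0 : 0 < e / (4 * M) by rewrite divr_gt0// mulr_gt0.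
have vu := uv; rewrite distrC in vu.
have h1 := average_le (ltW Mpos) d0 lh hM uv.
have h2 := average_le (ltW Mpos) d0 lh hM vu.
have e3 : 3 * M * (e / (4 * M)) = 3 / 4 * e by field; rewrite gt_eqF.
have e4 : 3 / 4 * e < e by rewrite gtr_pMl// ltr_pdivrMr// mul1r ltr_nat.
rewrite e3 in h1; rewrite e3 in h2.
by rewrite ltr_norml ltrNl opprB (le_lt_trans h2 e4) (le_lt_trans h1 e4).
Qed.

(** By [average_left_regular], translating [h] amounts to moving [u] on the sphere, so the
    invariance of [phi] passes to [L]. *)
Lemma invariant_mean_amenable : has_invariant_mean R (sphere_action mu) -> amenable mu.
Proof.
move=> [phi [mphi iphi]].
pose F h (u : L2sphere mu) : R[i]^o := (average h (val u))%:C%C.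
pose L h := complex.Re (phi (F h)).
have lbRe f : Linfty mu f -> locally_bounded (fun x => complex.Re (f x)).
  move=> [[mr _] [M fM]]; split => //; exists M; apply: locally_aeS fM => x /=.
  exact: le_trans (Re_le_normc _).
have lbIm f : Linfty mu f -> locally_bounded (fun x => complex.Im (f x)).
  move=> [[_ mi] [M fM]]; split => //; exists M; apply: locally_aeS fM => x /=.
  exact: le_trans (Im_le_normc _).
have Linv (g : G) h : locally_bounded h -> L (fun x => h (g * x)%g) = L h.
  move=> lh; rewrite /L -(iphi g (F h)); last exact: Cbu_average.
  congr (complex.Re (phi _)); apply/funext => u.
  by rewrite /F /= average_left_regular.
exists (complex_mean L); split.
  apply: (@mean_of_real _ _ _ _ _ locally_bounded).
  - by move=> f Lf; split; [exact: lbRe|exact: lbIm].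
  - split; first by split; exact: measurable_cst.
    by exists 1; apply: filterE => x /=; rewrite expr1n expr0n addr0 sqrtr1.
  - exact: locally_bounded_lin.
  - move=> a h k lh lk.
    have FE : F (fun x => a * h x + k x) = (a%:C%C : R[i]) *: F h + F k.
      apply/funext => u; rewrite /F average_lin// rmorphD rmorphM.
      by [].
    rewrite /L FE (mean_linear mphi); [|exact: Cbu_average..].
    by rewrite raddfD /=; case: (phi (F h)) => p q /=; rewrite mul0r subr0.
  - move=> h lh h0; have : 0 <= phi (F h).
      apply: (mean_positive mphi); first exact: Cbu_average.
      by move=> u _; rewrite /= /F lecR; exact: average_ge0.
    by rewrite lecE => /andP[].
  - rewrite /L (_ : F _ = fun=> 1) ?(mean_unit mphi)//.
    by apply/funext => u; rewrite /F average_cst.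
move=> g f Lf; rewrite /complex_mean; congr (_ +i* _)%C.
  exact: (Linv g _ (lbRe _ Lf)).
exact: (Linv g _ (lbIm _ Lf)).
Qed.

End mean_transfer.

Theorem proposition2p1 (R : realType) (G : topologicalGroupType)
    (hausdorffG : hausdorff_space G) (locally_compactG : locally_compact [set: G])
    (mu : left_haar R G) :
  (amenable mu <-> has_invariant_mean R (sphere_action mu)) /\
  (has_invariant_mean R (sphere_action mu) <->
   concentration_property (sphere_action mu)).
Proof.
have amenable_conc : amenable mu -> concentration_property (sphere_action mu).
  move=> am; apply: almost_invariant_concentration.
  exact: amenable_almost_invariant.
have conc_mean : concentration_property (sphere_action mu) ->
    has_invariant_mean R (sphere_action mu).
  apply: (@concentration_mean R _ _ (sphere_action mu) 1%g).
    by move=> u; apply/val_inj; rewrite /= left_regular1.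
  exact: sphere_action_unif.
have mean_amenable : has_invariant_mean R (sphere_action mu) -> amenable mu.
  exact: invariant_mean_amenable.
split; split.
- by move=> /amenable_conc/conc_mean.
- exact: mean_amenable.
- by move=> /mean_amenable/amenable_conc.
- exact: conc_mean.
Qed.
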